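(* Let $1<p,q<\infty$ with $\frac1p+\frac1q<1$, and let $n\in\mathbb N$. If $f(z)=\sum_{k\ge0}a_kz^k\in AT^q_p$, then the series $$\sum_{k\ge0}\frac{a_k}{n+k+1}$$ converges. Moreover, there is a positive constant $C=C(p,q)$ (independent of $f$) such that $$\sup_{n\in\mathbb N}\left|\sum_{k\ge0}\frac{a_k}{n+k+1}\right|\le C\,\|f\|_{AT^q_p}.$$
   Context: $\mathbb D$ is the open unit disc of $\mathbb C$, $\mathbb T$ the unit circle, $dA$ the normalized area Lebesgue measure on $\mathbb D$, $|d\xi|$ arc length on $\mathbb T$. For $\xi\in\mathbb T$ put $$\Gamma_{1/2}(\xi)=\{z\in\mathbb D:|z|<1/2\}\cup\bigcup_{|z|<1/2}[z,\xi),$$ where $[z,\xi)$ is the half-open line segment from $z$ to $\xi$. For $1<p,q<\infty$, $AT^q_p$ is the space of analytic functions $f$ on $\mathbb D$ such that $$\|f\|_{AT^q_p}=\left\{\int_{\mathbb T}\left(\int_{\Gamma_{1/2}(\xi)}|f(z)|^p\,\frac{dA(z)}{1-|z|^2}\right)^{q/p}|d\xi|\right\}^{1/q}<\infty.$$ *)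

(* Defs.v *)
From HB Require Import structures.
From mathcomp Require Import all_boot all_order all_algebra.
From mathcomp Require Import all_classical all_reals all_analysis.
From mathcomp Require Import complex.

Set Implicit Arguments.
Unset Strict Implicit.
Unset Printing Implicit Defensive.

Import Order.TTheory GRing.Theory Num.Theory.
Import numFieldNormedType.Exports.

Local Open Scope classical_set_scope.
Local Open Scope ring_scope.
Local Open Scope complex_scope.

(* The topology and the normed structure of R[i] over itself, which the
   library only gives to the alias R[i]^o. *)
HB.instance Definition _ (R : realType) := NormedModule.copy R[i] R[i]^o.

Section TentSpace.
Context {R : realType}.
Implicit Types (z xi : R[i]) (f : R[i] -> R[i]) (p q : R).

(* The modulus as an element of R; `|z| has type R[i]. *)
Definition cmod z : R := Normc.normc z.

Definition unit_disc : set R[i] := [set z | cmod z < 1].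

Definition segment_co z xi : set R[i] :=
  [set (1 - t%:C) * z + t%:C * xi | t in [set t : R | 0 <= t < 1]].

Definition Gamma_half xi : set R[i] :=
  [set z | unit_disc z /\ cmod z < 2^-1] `|`
  \bigcup_(z in [set z | cmod z < 2^-1]) segment_co z xi.

Let pi_inv_ge0 : 0 <= (pi : R)^-1. Proof. by rewrite invr_ge0 pi_ge0. Qed.

(* Normalized area measure, carried by R * R (R[i] has no measurable
   structure in the library); points are moved to R[i] by cplx. *)
Definition dA :
    {measure set (measurableTypeR R * measurableTypeR R) -> \bar R} :=
  mscale (NngNum pi_inv_ge0) (lebesgue_measure \x lebesgue_measure)%E.

Definition cplx (w : R * R) : R[i] := w.1 +i* w.2.

Definition unit_circle_point (t : R) : R[i] := cos t +i* sin t.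

(* On R[i], derivability in the direction 1 is complex differentiability. *)
Definition analytic_on_disc f : Prop :=
  forall z, unit_disc z -> derivable f z 1.

(* \int_{Gamma_{1/2}(xi)} |f(z)|^p dA(z) / (1 - |z|^2) *)
Definition area_integral p f xi : \bar R :=
  (\int[dA]_(w in cplx @^-1` Gamma_half xi)
     (cmod (f (cplx w)) `^ p / (1 - cmod (cplx w) ^+ 2))%:E)%E.

(* Arc length on the circle is Lebesgue measure in t on [0, 2 pi[,
   with xi = e^{it}; the value may be +oo. *)
Definition AT_norm p q f : \bar R :=
  ((\int[lebesgue_measure]_(t in `[0%R, (2 * pi)%R[)
      (area_integral p f (unit_circle_point t) `^ (q / p))) `^ q^-1)%E.

Definition AT_space p q : set (R[i] -> R[i]) :=
  [set f | analytic_on_disc f /\ (AT_norm p q f < +oo)%E].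

End TentSpace.

(* Main.v *)
From HB Require Import structures.
Require Import Defs.
From mathcomp Require Import all_boot all_order all_algebra.
From mathcomp Require Import all_classical all_reals all_analysis.
From mathcomp Require Import complex.
From mathcomp Require Import measurable_realfun ring lra.

Set Implicit Arguments.
Unset Strict Implicit.
Unset Printing Implicit Defensive.
Import Order.TTheory GRing.Theory Num.Theory.
Import numFieldNormedType.Exports.

Local Open Scope classical_set_scope.
Local Open Scope ring_scope.
Local Open Scope complex_scope.

(** Put c_k = 1 / (n + k + 1), and let N <= k < L <= 2N be a dyadic block.
    By orthogonality of the characters, for every w with 0 < |w| < 1,
      sum_{N <= k < L} a_k c_k = (1 / 2 pi) int_0^{2 pi} f(e^{it} w) K(e^{it} w) dt,
    where K(z) = sum_{N <= k < L} c_k z^{-k}.  When 1 - |w| is comparable to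
    1 / N, Abel summation gives |K(e^{it} w)| <= 12 / (1 + N |1 - e^{it}|).
    Averaging over w in a small square of side comparable to 1 / N around
    1 - 1 / (4N), whose rotation by e^{it} lies in Gamma_{1/2}(e^{it}), and
    applying Hoelder's inequality first in w with exponent p and then in t with
    exponent q, one bounds the block by C N^{-(1 - 1/p - 1/q)} ||f||, uniformly
    in n.  Since 1/p + 1/q < 1, the dyadic blocks sum like a geometric series,
    which gives both the convergence and the bound. *)

(** * Integration *)

(** The exponents come from the following count. A square of side comparable to delta has area of
    order delta^2, while 1 - |z|^2 is of order delta on it; after division by the area, Hoelder's
    inequality in w therefore costs delta^(-1/p). It pays to take delta as large as possible, and
    the limit is set by the kernel: the powers |z|^-k with k <= 2N stay bounded only while delta is
    O(1 / N). At this scale the kernel is concentrated on an arc of length about 1 / N, so its norm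
    with exponent conjugate to q is of order N^-(1 - 1/q), and the product is N^(1/p + 1/q - 1).

    Uniformity in n holds because the coefficients 1 / (n + k + 1) enter only through their
    monotonicity in k and the bound 1 / N.

    Measurability shapes the argument. [area_integral] is shown neither measurable in t nor finite,
    so all exchanges of integrals and both uses of Hoelder's inequality concern integrals over the
    squares; [area_integral] enters only at the end, by monotonicity. *)

Section Integration.
Context d (T : measurableType d) (R : realType).
Variable mu : {measure set T -> \bar R}.
Local Open Scope ereal_scope.

Import HBNNSimple.

(** The integral of a nonnegative function is a supremum over the simple functions below it, so
    enlarging the function or the domain enlarges the family of competitors. No measurability
    enters, which is what permits comparison with integrals over [Gamma_half] and with
    [area_integral] as a function of t. *)
Lemma ge0_le_integral_subset (D E : set T) (f g : T -> \bar R) :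
  D `<=` E -> (forall x, D x -> 0 <= f x) -> (forall x, E x -> 0 <= g x) ->
  (forall x, D x -> f x <= g x) ->
  \int[mu]_(x in D) f x <= \int[mu]_(x in E) g x.
Proof.
move=> DE f0 g0 fg; rewrite !ge0_integralE//; apply: ereal_sup_le.
move=> _ [h hf <-] /=.
exists h => // x; rewrite (le_trans (hf x))// /patch.
case: ifPn => xD; last first.
  by case: ifPn => // /set_mem; exact: g0.
by move/set_mem: xD => xD; rewrite ifT ?fg// inE; exact: DE.
Qed.

Lemma hoelder_subset (D : set T) (f g : T -> R) (p q : R) :
  measurable D -> measurable_fun D f -> measurable_fun D g ->
  (forall x, D x -> 0 <= f x)%R -> (forall x, D x -> 0 <= g x)%R ->
  (0 < p)%R -> (0 < q)%R -> (p^-1 + q^-1 = 1)%R ->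
  \int[mu]_(x in D) (f x * g x)%:E <=
  (\int[mu]_(x in D) (f x `^ p)%:E) `^ p^-1 *
  (\int[mu]_(x in D) (g x `^ q)%:E) `^ q^-1.
Proof.
move=> mD mf mg f0 g0 p0 q0 pq.
have mf' : measurable_fun setT (f \_ D) by apply/(measurable_restrictT _ _).1.
have mg' : measurable_fun setT (g \_ D) by apply/(measurable_restrictT _ _).1.
have := hoelder mu mf' mg' p0 q0 pq.
rewrite Lnorm1 unlock /=.
have powE (u : T -> R) r : (0 < r)%R -> (forall x, D x -> 0 <= u x)%R ->
    \int[mu]_x (`|((u \_ D) x)%:E| `^ r) = \int[mu]_(x in D) (u x `^ r)%:E.
  move=> r0 u0; rewrite [RHS]integral_mkcond; apply: eq_integral => x _.
  rewrite /patch; case: ifPn => [/set_mem xD|_].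
    by rewrite /= ger0_norm ?u0// poweR_EFin.
  by rewrite /= normr0 powR0// gt_eqF.
rewrite !powE//; congr (_ <= _).
rewrite [RHS]integral_mkcond; apply: eq_integral => x _.
rewrite /patch; case: ifPn => [/set_mem xD|_].
  by rewrite /= ger0_norm ?mulr_ge0 ?u0 ?f0 ?g0.
by rewrite /= mulr0 normr0.
Qed.

End Integration.

Section PlaneMeasure.
Context {R : realType}.
Local Notation mu := (@lebesgue_measure R).

(* The library does not infer that a product of sigma-finite measures is
   sigma-finite, which Tonelli's theorem needs. *)
Definition plane_measure :
  set (measurableTypeR R * measurableTypeR R)%type -> \bar R := (mu \x mu)%E.

HB.instance Definition _ := Measure.on plane_measure.

Lemma sigma_finite_plane_measure : sigma_finite setT plane_measure.
Proof.
pose J n : set (measurableTypeR R) := `[- n%:R, n%:R]%classic.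
exists (fun n => J n `*` J n) => [|n].
  apply/esym; rewrite -subTset => -[x y] _.
  exists (Num.truncn (`|x| + `|y|)).+1 => //.
  have := truncnS_gt (`|x| + `|y|).
  have := normr_ge0 x; have := normr_ge0 y.
  by split; rewrite /J /= in_itv/= -ler_norml; lra.
have mJ : measurable (J n) by exact: measurable_itv.
split; first exact: measurableX.
have -> : plane_measure (J n `*` J n) = (mu (J n) * mu (J n))%E.
  exact: product_measure1E.
have -> : mu (J n) = (if (- n%:R < n%:R :> R)%R then n%:R - - n%:R else 0)%:E.
  by have := lebesgue_measure_itv `[- n%:R, n%:R : R]; rewrite /= lte_fin => ->; case: ifP.
by rewrite -EFinM ltry.
Qed.

HB.instance Definition _ :=
  Measure_isSigmaFinite.Build _ _ _ plane_measure sigma_finite_plane_measure.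

End PlaneMeasure.

Section Rotation.
Context {R : realType}.
Local Notation mu := (@lebesgue_measure R).
Local Open Scope ereal_scope.

(** By uniqueness of Lebesgue measure, it is enough that translation preserves the length of
    half-open intervals. *)
Lemma lebesgue_measure_translation (c : R) (A : set R) : measurable A ->
  pushforward mu ((fun x => x + c)%R : _ -> measurableTypeR R) A = mu A.
Proof.
move=> mA; apply/esym.
have mc : measurable_fun [set: measurableTypeR R]
    ((fun x => x + c)%R : _ -> measurableTypeR R).
  exact: measurable_funD.
apply/lebesgue_measure_unique => //= _ [[a b]] _ <-.
rewrite /pushforward/=.
rewrite (_ : _ @^-1` _ = [set` `]a - c, b - c]%R])%R; last first.
  by apply/seteqP; split => x /=; rewrite !in_itv/= ltrBlDr lerBrDr.
rewrite !lebesgue_measure_itv/= !lte_fin ltrD2r.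
by case: ifPn => // _; rewrite -EFinB; congr (_%:E); ring.
Qed.

Lemma ge0_integral_translation (c : R) (f : R -> \bar R) :
  measurable_fun [set: R] f -> (forall x, 0 <= f x) ->
  \int[mu]_x f (x + c)%R = \int[mu]_x f x.
Proof.
move=> mf f0.
have mc : measurable_fun [set: measurableTypeR R]
    ((fun x => x + c)%R : _ -> measurableTypeR R).
  exact: measurable_funD.
transitivity (\int[pushforward mu ((fun x => x + c)%R : _ -> measurableTypeR R)]_x f x).
  by rewrite ge0_integral_pushforward.
by apply: eq_measure_integral => //= A mA _; exact: lebesgue_measure_translation.
Qed.

Local Notation mu2 := (@plane_measure R).

(** Tonelli with the first coordinate innermost: on each horizontal line the shear is a translation,
    by the constant [a * y]. *)
Lemma ge0_integral_shearl (a : R) (G : R * R -> \bar R) :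
  measurable_fun setT G -> (forall w, 0 <= G w) ->
  \int[mu2]_w G (w.1 + a * w.2, w.2)%R = \int[mu2]_w G w.
Proof.
move=> mG G0.
have ms : measurable_fun [set: measurableTypeR R * measurableTypeR R]
    ((fun w => (w.1 + a * w.2, w.2)%R) : _ -> measurableTypeR R * measurableTypeR R).
  apply/measurable_fun_pair => //=; apply: measurable_funD => //.
  exact: measurable_funM.
rewrite !fubini_tonelli2//; last exact: measurableT_comp ms.
apply: eq_integral => y _; rewrite /fubini_G /=.
rewrite (ge0_integral_translation (a * y) (f := fun x => G (x, y)))//.
exact: measurableT_comp.
Qed.

Lemma ge0_integral_shearr (a : R) (G : R * R -> \bar R) :
  measurable_fun setT G -> (forall w, 0 <= G w) ->
  \int[mu2]_w G (w.1, w.2 + a * w.1)%R = \int[mu2]_w G w.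
Proof.
move=> mG G0.
have ms : measurable_fun [set: measurableTypeR R * measurableTypeR R]
    ((fun w => (w.1, w.2 + a * w.1)%R) : _ -> measurableTypeR R * measurableTypeR R).
  apply/measurable_fun_pair => //=; apply: measurable_funD => //.
  exact: measurable_funM.
rewrite !fubini_tonelli1//; last exact: measurableT_comp ms.
apply: eq_integral => x _; rewrite /fubini_F /=.
rewrite (ge0_integral_translation (a * x) (f := fun y => G (x, y)))//.
exact: measurableT_comp.
Qed.

Definition rotate (c s : R) (w : R * R) : R * R :=
  (c * w.1 - s * w.2, s * w.1 + c * w.2)%R.

Lemma measurable_rotate (c s : R) :
  measurable_fun [set: measurableTypeR R * measurableTypeR R]
    (rotate c s : _ -> measurableTypeR R * measurableTypeR R).
Proof.
apply/measurable_fun_pair => /=.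
  by apply: measurable_funB; apply: measurable_funM.
by apply: measurable_funD; apply: measurable_funM.
Qed.

(* A rotation with [s != 0] is a product of three shears; the half turn is the
   square of the quarter turn. *)
Lemma ge0_integral_rotate (c s : R) (G : R * R -> \bar R) :
  (c ^+ 2 + s ^+ 2 = 1)%R ->
  measurable_fun setT G -> (forall w, 0 <= G w) ->
  \int[mu2]_w G (rotate c s w) = \int[mu2]_w G w.
Proof.
have key c' s' (H : R * R -> \bar R) : (c' ^+ 2 + s' ^+ 2 = 1)%R -> s' != 0%R ->
    measurable_fun setT H -> (forall w, 0 <= H w) ->
    \int[mu2]_w H (rotate c' s' w) = \int[mu2]_w H w.
  move=> cs s0 mH H0.
  have ms a : measurable_fun [set: measurableTypeR R * measurableTypeR R]
      ((fun w => (w.1 + a * w.2, w.2)%R) : _ -> measurableTypeR R * measurableTypeR R).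
    apply/measurable_fun_pair => //=; apply: measurable_funD => //.
    exact: measurable_funM.
  have ms' a : measurable_fun [set: measurableTypeR R * measurableTypeR R]
      ((fun w => (w.1, w.2 + a * w.1)%R) : _ -> measurableTypeR R * measurableTypeR R).
    apply/measurable_fun_pair => //=; apply: measurable_funD => //.
    exact: measurable_funM.
  (* For the angle x this is minus the tangent of x / 2, the coefficient for which the horizontal,
     vertical, horizontal shears compose to the rotation: the diagonal entries [1 + a * s'] equal
     [c'], and the upper right entry [a * (c' + 1)] equals [- s'] because the squares add up to
     1. *)
  pose a := ((c' - 1) / s')%R.
  rewrite -(ge0_integral_shearl a mH H0).
  rewrite -(ge0_integral_shearr s' (G := fun w => H (w.1 + a * w.2, w.2)%R))//;
    last exact: measurableT_comp mH (ms a).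
  rewrite -(ge0_integral_shearl a (G := fun w =>
     H (w.1 + a * (w.2 + s' * w.1), w.2 + s' * w.1)%R))//; last first.
    exact: measurableT_comp (measurableT_comp mH (ms a)) (ms' s').
  apply: eq_integral => -[x y] _ /=; congr H; rewrite /rotate /=.
  have as' : (a * s' = c' - 1)%R by rewrite /a divfK.
  have ac : (a * (c' + 1) = - s')%R.
    apply: (mulIf s0); rewrite mulrAC as'.
    have -> : (- s' * s' = - (s' ^+ 2))%R by ring.
    rewrite (_ : s' ^+ 2 = 1 - c' ^+ 2)%R; first by ring.
    by rewrite -cs; ring.
  congr pair.
    transitivity (x + a * s' * x + a * (a * s' + 2) * y)%R; last ring.
    rewrite as'; have -> : (a * (c' - 1 + 2) = a * (c' + 1))%R by ring.
    rewrite ac; ring.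
  transitivity (s' * x + (1 + a * s') * y)%R; last ring.
  by rewrite as'; ring.
move=> cs mG G0; have [s0|s0] := eqVneq s 0%R; last exact: key.
have : (c ^+ 2 = 1 ^+ 2)%R by move: cs; rewrite s0 expr1n => <-; ring.
move/eqP; rewrite eqf_sqr => /orP[/eqP c1|/eqP c1].
  apply: eq_integral => -[x y] _; rewrite /rotate c1 s0 /=.
  by rewrite !mul1r !mul0r subr0 add0r.
have q0 : (0 ^+ 2 + 1 ^+ 2 = 1 :> R)%R by ring.
rewrite -(key 0%R 1%R G q0 (oner_neq0 _) mG G0).
have mG' := measurableT_comp mG (measurable_rotate 0 1).
rewrite -(key 0%R 1%R (G \o rotate 0 1) q0 (oner_neq0 _) mG' (fun w => G0 _)).
apply: eq_integral => -[x y] _; rewrite /rotate c1 s0 /=.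
by congr (G (_, _)); ring.
Qed.

End Rotation.

(** * Orthogonality on the circle *)

Section Modulus.
Context {R : realType}.
Implicit Types (z w : R[i]) (t : R).

Lemma normc_cmod z : `|z| = (cmod z)%:C.
Proof. by rewrite normc_def; case: z. Qed.

Lemma cmod_ge0 z : 0 <= cmod z.
Proof. by case: z => x y; rewrite /cmod /= sqrtr_ge0. Qed.

Lemma cmod0 : cmod (0 : R[i]) = 0.
Proof. exact: Normc.normc0. Qed.

Lemma cmod1 : cmod (1 : R[i]) = 1.
Proof. exact: Normc.normc1. Qed.

Lemma cmodM z w : cmod (z * w) = cmod z * cmod w.
Proof. exact: Normc.normcM. Qed.

Lemma cmodV z : cmod z^-1 = (cmod z)^-1.
Proof. exact: Normc.normcV. Qed.

Lemma cmodN z : cmod (- z) = cmod z.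
Proof. exact: normcN. Qed.

Lemma ler_cmodD z w : cmod (z + w) <= cmod z + cmod w.
Proof. exact: le_normcD. Qed.

Lemma ler_cmodB z w : cmod (z - w) <= cmod z + cmod w.
Proof. by rewrite -(cmodN w) ler_cmodD. Qed.

Lemma cmodX z n : cmod (z ^+ n) = cmod z ^+ n.
Proof. by elim: n => [|n ih]; rewrite ?expr0 ?cmod1// !exprS cmodM ih. Qed.

Lemma cmod_real (x : R) : cmod x%:C = `|x|.
Proof. by rewrite /cmod /= expr0n addr0 sqrtr_sqr. Qed.

Lemma cmod_natr n : cmod (n%:R : R[i]) = n%:R.
Proof. by rewrite -(rmorph_nat (real_complex R)) cmod_real normr_nat. Qed.

Lemma cmod_eq0 z : cmod z = 0 -> z = 0.
Proof. exact: Normc.eq0_normc. Qed.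

Lemma ler_cmod_sum I (r : seq I) (P : pred I) (F : I -> R[i]) :
  cmod (\sum_(i <- r | P i) F i) <= \sum_(i <- r | P i) cmod (F i).
Proof.
elim/big_rec2: _ => [|i x y _ xy]; first by rewrite cmod0.
by rewrite (le_trans (ler_cmodD _ _))// lerD2l.
Qed.

Lemma Re_le_cmod z : `|complex.Re z| <= cmod z.
Proof.
case: z => x y; rewrite /cmod /= -sqrtr_sqr ler_wsqrtr//.
by rewrite lerDl sqr_ge0.
Qed.

Lemma Im_le_cmod z : `|complex.Im z| <= cmod z.
Proof.
case: z => x y; rewrite /cmod /= -sqrtr_sqr ler_wsqrtr//.
by rewrite lerDr sqr_ge0.
Qed.

Lemma cmod_le_ReIm z : cmod z <= `|complex.Re z| + `|complex.Im z|.
Proof.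
case: z => x y; rewrite {1}[x +i* y]complexE.
rewrite (le_trans (ler_cmodD _ _))// cmodM !cmod_real.
by rewrite /cmod /= expr0n add0r expr1n sqrtr1 mul1r.
Qed.

(** Rotating z onto the positive axis by its normalized conjugate reduces a modulus to a real part,
    so that only real integrals have to be computed. The witness is 0 at z = 0, hence an inequality
    for [u]. *)
Lemma cmod_polar z : exists2 u, cmod u <= 1 & complex.Re (u * z) = cmod z.
Proof.
have [->|z0] := eqVneq z 0.
  by exists 0; rewrite ?cmod0// mul0r.
have m0 : cmod z != 0 by apply: contra_neq z0; exact: cmod_eq0.
exists ((cmod z)^-1%:C * z^*%C).
  rewrite cmodM cmod_real ger0_norm ?invr_ge0 ?cmod_ge0//.
  suff -> : cmod z^*%C = cmod z by rewrite mulVf.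
  by case: (z) => x y; rewrite /cmod /= sqrrN.
have : cmod z ^+ 2 = complex.Re z ^+ 2 + complex.Im z ^+ 2.
  by case: (z) => x y; rewrite /cmod /= sqr_sqrtr// addr_ge0 ?sqr_ge0.
case: (z) m0 => x y /= m0 m2.
move: m0 m2; set m := Num.sqrt _ => m0 m2.
apply: (mulfI m0); rewrite -expr2 m2.
by field.
Qed.

Local Notation e := (@unit_circle_point R).

Lemma cmod_unit_circle t : cmod (e t) = 1.
Proof. by rewrite /cmod /= cos2Dsin2 sqrtr1. Qed.

Lemma unit_circle0 : e 0 = 1.
Proof. by rewrite /unit_circle_point cos0 sin0. Qed.

Lemma unit_circleD s t : e (s + t) = e s * e t.
Proof.
rewrite /unit_circle_point cosD sinD; apply/eqP; rewrite eq_complex /=.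
by rewrite eqxx/= addrC eqxx.
Qed.

Lemma unit_circleX t n : e t ^+ n = e (n%:R * t).
Proof.
elim: n => [|n ih]; first by rewrite mul0r unit_circle0.
by rewrite exprS ih -unit_circleD -natr1 mulrDl mul1r addrC.
Qed.

Lemma unit_circle_neq0 t : e t != 0.
Proof.
by apply/eqP => /(congr1 cmod)/eqP; rewrite cmod_unit_circle cmod0 oner_eq0.
Qed.

Lemma unit_circleN t : e (- t) = (e t)^-1.
Proof.
apply: (mulfI (unit_circle_neq0 t)).
by rewrite -unit_circleD subrr unit_circle0 mulfV// unit_circle_neq0.
Qed.

Lemma unit_circle2pi : e (2 * pi) = 1.
Proof.
by rewrite mulr_natl /unit_circle_point cos2pi sin2pi.
Qed.

Lemma unit_circle_period (j k : nat) : e ((j%:R - k%:R) * (2 * pi)) = 1.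
Proof.
rewrite mulrBl unit_circleD unit_circleN -!(unit_circleX (2 * pi)) unit_circle2pi.
by rewrite !expr1n mulfV// oner_neq0.
Qed.

Lemma unit_circle_rotate t (w : R * R) :
  e t * cplx w = cplx (rotate (cos t) (sin t) w).
Proof. by rewrite /cplx /rotate /= (addrC (sin t * _)). Qed.

End Modulus.

Section CircleIntegral.
Context {R : realType}.
Local Notation e := (@unit_circle_point R).
Local Notation mu := (@lebesgue_measure R).

(** Carrying an explicit antiderivative makes finite sums of characters a matter of adding
    primitives; the fundamental theorem of calculus is then applied once, to the whole sum. *)
Definition circle_primitive (phi : R -> R) (v : R) :=
  continuous phi /\
  exists2 F : R -> R, (forall t : R, is_derive t 1 F (phi t)) & F (2 * pi) - F 0 = v.

Lemma circle_primitive0 : circle_primitive (fun=> 0) 0.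
Proof.
split; first by move=> t; exact: cvg_cst.
by exists (fun=> 0) => [t|]; [exact: is_derive_cst|rewrite subrr].
Qed.

Lemma circle_primitiveD phi psi u v :
  circle_primitive phi u -> circle_primitive psi v ->
  circle_primitive (fun t => phi t + psi t) (u + v).
Proof.
move=> [cphi [F dF <-]] [cpsi [G dG <-]]; split.
  by move=> t; apply: cvgD; [exact: cphi|exact: cpsi].
exists (F + G) => [t|]; first exact: is_deriveD.
by rewrite /= !fctE; ring.
Qed.

Lemma circle_primitive_sum I (r : seq I) (P : pred I) (phi : I -> R -> R) (v : I -> R) :
  (forall i, P i -> circle_primitive (phi i) (v i)) ->
  circle_primitive (fun t => \sum_(i <- r | P i) phi i t) (\sum_(i <- r | P i) v i).
Proof.
move=> h; elim: r => [|i r ih].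
  rewrite big_nil; under eq_fun do rewrite big_nil; exact: circle_primitive0.
rewrite big_cons; under eq_fun do rewrite big_cons.
by case: ifPn => // Pi; exact: circle_primitiveD (h _ Pi) ih.
Qed.

Lemma circle_primitive_unit_circle (b : R[i]) (j k : nat) :
  circle_primitive (fun t => complex.Re (b * e ((j%:R - k%:R) * t)))
    (if j == k then 2 * pi * complex.Re b else 0).
Proof.
case: b => x y.
have [->|jk] := eqVneq j k.
  under eq_fun do rewrite subrr mul0r unit_circle0 mulr1 /=.
  split; first by move=> t; exact: cvg_cst.
  exists (fun t => t * x) => [t|]; last by rewrite mul0r subr0.
  by apply: is_derive_eq; rewrite /GRing.scale /= mulr1 mulr0 add0r.
set m : R := j%:R - k%:R.
have m0 : m != 0 by rewrite /m subr_eq0 eqr_nat.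
under eq_fun do rewrite /unit_circle_point /=.
have linc : continuous (fun t : R => m * t).
  by move=> t; apply: cvgM; [exact: cvg_cst|exact: cvg_id].
split.
  move=> t; apply: cvgB; apply: cvgM; try exact: cvg_cst.
    by apply: continuous_comp; [exact: linc|exact: continuous_cos].
  by apply: continuous_comp; [exact: linc|exact: continuous_sin].
(* The real part of b e^{imt} / (im). Since m is a nonzero integer, it takes the same value at 0 and
   2 pi. *)
exists (fun t => m^-1 * (x * sin (m * t) + y * cos (m * t))) => [t|].
  have dl : is_derive t 1 (fun t => m * t) m.
    rewrite (_ : (fun t => m * t) = (fun t => t * m)); last first.
      by apply/funext => s; rewrite mulrC.
    by apply: is_derive_eq; rewrite /GRing.scale /= mulr1 mulr0 add0r.
  have ds : is_derive t 1 (fun t => sin (m * t)) (cos (m * t) * m).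
    exact: is_derive1_comp.
  have dc : is_derive t 1 (fun t => cos (m * t)) (- sin (m * t) * m).
    exact: is_derive1_comp.
  apply: is_derive_eq; rewrite /GRing.scale /=; field; exact: m0.
have := unit_circle_period (R := R) j k; rewrite -/m => em.
have /= -> := congr1 (@complex.Re R) em; have /= -> := congr1 (@complex.Im R) em.
by rewrite !mulr0 sin0 cos0; ring.
Qed.

Lemma integral_circle_primitive phi v : circle_primitive phi v ->
  (\int[mu]_(t in `[0%R, (2 * pi)%R[) (phi t)%:E = v%:E)%E.
Proof.
move=> [cphi [F dF <-]].
have pi2 : 0 < 2 * pi :> R by rewrite mulr_gt0// pi_gt0.
rewrite integral_itv_bndo_bndc; last first.
  apply/measurable_EFinP; apply: measurable_funTS.
  exact: continuous_measurable_fun.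
rewrite (@continuous_FTC2 _ phi F)//.
- exact: continuous_subspaceT.
- have cF : continuous F.
    by move=> t; apply: differentiable_continuous; apply/derivable1_diffP; exact: ex_derive.
  split => [t _||]; first exact: ex_derive.
    by apply: cvg_at_right_filter; exact: cF.
  by apply: cvg_at_left_filter; exact: cF.
- by move=> t _; rewrite derive1E derive_val.
Qed.

(* Orthogonality of the characters [t |-> e t ^+ j] singles out the diagonal
   terms of the product of [\sum_j a_j z^j] and [\sum_k c_k z^-k]. *)
Lemma circle_primitive_pairing (u w : R[i]) (a c : nat -> R[i]) (J L : nat) :
  w != 0 -> (L <= J)%N ->
  circle_primitive
    (fun t => complex.Re (u * ((\sum_(j < J) a j * (e t * w) ^+ j) *
                               (\sum_(k < L) c k * (e t * w) ^- k))))
    (2 * pi * complex.Re (u * \sum_(k < L) a k * c k)).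
Proof.
move=> w0 LJ.
have -> : (fun t => complex.Re (u * ((\sum_(j < J) a j * (e t * w) ^+ j) *
                               (\sum_(k < L) c k * (e t * w) ^- k)))) =
  (fun t => \sum_(k < L) \sum_(j < J)
     complex.Re (u * a j * c k * w ^+ j * w ^- k * e ((j%:R - k%:R) * t))).
  apply/funext => t; rewrite mulrC big_distrlr/= exchange_big/= mulr_suml.
  rewrite (raddf_sum (@complex.Re R : Rcomplex R -> R)); apply: eq_bigr => k _.
  rewrite mulr_suml (raddf_sum (@complex.Re R : Rcomplex R -> R)).
  apply: eq_bigr => j _; congr complex.Re.
  rewrite mulrBl unit_circleD unit_circleN -!unit_circleX !exprMn invfM; ring.
have -> : 2 * pi * complex.Re (u * \sum_(k < L) a k * c k) =
  \sum_(k < L) \sum_(j < J) (if j == k :> nat then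
     2 * pi * complex.Re (u * a j * c k * w ^+ j * w ^- k) else 0).
  rewrite mulr_sumr (raddf_sum (@complex.Re R : Rcomplex R -> R)) mulr_sumr.
  apply: eq_bigr => k _; rewrite -big_mkcond/=.
  (* [L <= J] puts every [k < L] in the range of j, so each diagonal term is present, and its powers
     of w cancel. *)
  rewrite (big_ord1_eq _ (fun j =>
    2 * pi * complex.Re (u * a j * c k * w ^+ j / w ^+ k))) ifT; last first.
    exact: leq_trans LJ.
  by congr (_ * complex.Re _); rewrite -[RHS]mulrA divff ?mulr1 ?mulrA// expf_neq0.
by do 2 (apply: circle_primitive_sum => ? _); exact: circle_primitive_unit_circle.
Qed.

End CircleIntegral.

(** * Power series *)

Section ComplexConvergence.
Context {R : realType}.

(** A positive element of [R[i]] has zero imaginary part, so real radii account for all balls. *)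
Lemma cvg_cmodP (u : nat -> R[i]) (l : R[i]) :
  u @ \oo --> l <->
  forall eps : R, 0 < eps -> \forall n \near \oo, cmod (l - u n) < eps.
Proof.
split=> [/cvgrPdist_lt ul eps eps0|h].
  have e0 : 0 < eps%:C :> R[i] by rewrite ltcR.
  by apply: filterS (ul _ e0) => n; rewrite normc_cmod ltcR.
apply/cvgrPdist_lt => -[x y]; rewrite ltcE /= => /andP[/eqP -> x0].
by apply: filterS (h _ x0) => n; rewrite normc_cmod ltcR.
Qed.

Lemma ler_dist_cmod (z w : R[i]) : `|cmod z - cmod w| <= cmod (z - w).
Proof.
rewrite ler_distl; apply/andP; split.
  by rewrite lerBlDr -(cmodN (z - w)) opprB -{1}(subrK z w) addrC ler_cmodD.
by rewrite -{1}(subrK w z) addrC ler_cmodD.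
Qed.

Section Measurability.
Context d (T : measurableType d).
Implicit Types (D : set T) (g h : T -> R[i]).

Definition measurable_complex D h :=
  measurable_fun D (fun x => complex.Re (h x)) /\
  measurable_fun D (fun x => complex.Im (h x)).

Lemma measurable_complex_cst D z : measurable_complex D (fun=> z).
Proof. by split; exact: measurable_cst. Qed.

Lemma measurable_complex_add D g h :
  measurable_complex D g -> measurable_complex D h -> measurable_complex D (fun x => g x + h x).
Proof.
move=> [g1 g2] [h1 h2]; split.
  rewrite (_ : (fun _ => _) = (fun x => complex.Re (g x) + complex.Re (h x))).
    exact: measurable_funD.
  by apply/funext => x; case: (g x) (h x) => ? ? [].
rewrite (_ : (fun _ => _) = (fun x => complex.Im (g x) + complex.Im (h x))).
  exact: measurable_funD.
by apply/funext => x; case: (g x) (h x) => ? ? [].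
Qed.

Lemma measurable_complex_mul D g h :
  measurable_complex D g -> measurable_complex D h -> measurable_complex D (fun x => g x * h x).
Proof.
move=> [g1 g2] [h1 h2]; split.
  rewrite (_ : (fun _ => _) = (fun x => complex.Re (g x) * complex.Re (h x) -
                                        complex.Im (g x) * complex.Im (h x))).
    by apply: measurable_funB; exact: measurable_funM.
  by apply/funext => x; case: (g x) (h x) => ? ? [].
rewrite (_ : (fun _ => _) = (fun x => complex.Re (g x) * complex.Im (h x) +
                                      complex.Im (g x) * complex.Re (h x))).
  by apply: measurable_funD; exact: measurable_funM.
by apply/funext => x; case: (g x) (h x) => ? ? [].
Qed.

Lemma measurable_complex_exp D h n :
  measurable_complex D h -> measurable_complex D (fun x => h x ^+ n).
Proof.
move=> mh; elim: n => [|n ih].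
  by under eq_fun do rewrite expr0; exact: measurable_complex_cst.
by under eq_fun do rewrite exprS; exact: measurable_complex_mul.
Qed.

Lemma measurable_complex_sum D I (r : seq I) (P : pred I) (h : I -> T -> R[i]) :
  (forall i, P i -> measurable_complex D (h i)) ->
  measurable_complex D (fun x => \sum_(i <- r | P i) h i x).
Proof.
move=> mh; elim: r => [|i r ih].
  by under eq_fun do rewrite big_nil; exact: measurable_complex_cst.
under eq_fun do rewrite big_cons.
have [Pi|//] := boolP (P i).
by apply: measurable_complex_add => //; exact: mh.
Qed.

Lemma measurable_complex_cmod D h : measurable D ->
  measurable_complex D h -> measurable_fun D (fun x => cmod (h x)).
Proof.
move=> mD [h1 h2].
rewrite (_ : (fun _ => _) = (fun x =>
  (complex.Re (h x) ^+ 2 + complex.Im (h x) ^+ 2) `^ 2^-1)).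
  apply: (@measurableT_comp _ _ _ _ _ _ (fun x : R => x `^ 2^-1)).
    exact: measurable_powR.
  by apply: measurable_funD; exact: measurable_funX.
apply/funext => x; rewrite powR12_sqrt ?addr_ge0 ?sqr_ge0//.
by case: (h x).
Qed.

End Measurability.

End ComplexConvergence.

Section PowerSeries.
Context {R : realType}.
Variables (f : R[i] -> R[i]) (a : nat -> R[i]).
Hypothesis fa : forall z, unit_disc z ->
  series (fun k : nat => a k * z ^+ k) @ \oo --> f z.

Lemma power_series_tail (rho : R) : 0 <= rho < 1 ->
  exists M q, [/\ 0 <= M, 0 <= q < 1 & forall J z, cmod z <= rho ->
    cmod (f z - \sum_(k < J) a k * z ^+ k) <= M * q ^+ J].
Proof.
move=> /andP[rho0 rho1]; pose r : R := (1 + rho) / 2.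
have r0 : 0 < r by rewrite /r; lra.
have r1 : r < 1 by rewrite /r; lra.
have rhor : rho < r by rewrite /r; lra.
have [M0 M00 aM] : exists2 M0, 0 <= M0 & forall k, cmod (a k) * r ^+ k <= M0.
  have ur : unit_disc r%:C by rewrite /unit_disc /mkset cmod_real gtr0_norm.
  have /cvg_cmodP/(_ _ ltr01) [N _ hN] := fa ur.
  (* From N on, a term is the difference of two partial sums within 1 of the limit, hence at most 2;
     the sum takes care of the earlier terms. *)
  exists (2 + \sum_(k < N) cmod (a k) * r ^+ k).
    rewrite addr_ge0// sumr_ge0// => i _.
    by rewrite mulr_ge0 ?cmod_ge0 ?exprn_ge0// ltW.
  have rk k : cmod (a k) * r ^+ k = cmod (a k * r%:C ^+ k).
    by rewrite cmodM cmodX cmod_real gtr0_norm.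
  move=> k; have [kN|Nk] := ltnP k N.
    rewrite (bigD1 (Ordinal kN))//= addrCA lerDl addr_ge0// sumr_ge0// => i _.
    by rewrite mulr_ge0 ?cmod_ge0 ?exprn_ge0// ltW.
  rewrite ler_wpDr ?sumr_ge0// => [i _|].
    by rewrite mulr_ge0 ?cmod_ge0 ?exprn_ge0// ltW.
  rewrite rk; set s := series (fun k => a k * r%:C ^+ k) in hN.
  have -> : a k * r%:C ^+ k = (f r%:C - s k) - (f r%:C - s k.+1).
    by rewrite /s /series /= big_nat_recr//=; ring.
  rewrite (le_trans (ler_cmodB _ _))//.
  have := hN k Nk; have := hN k.+1 (leqW Nk); rewrite /=; lra.
pose q := rho / r.
have q0 : 0 <= q by rewrite divr_ge0// ltW.
have q1 : q < 1 by rewrite ltr_pdivrMr// mul1r.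
have q1' : 1 - q != 0 by rewrite subr_eq0 eq_sym lt_eqF.
exists (M0 / (1 - q)), q; split; rewrite ?q0 ?divr_ge0 ?subr_ge0// ?ltW//.
move=> J z zr.
have zk k : cmod (a k * z ^+ k) <= M0 * q ^+ k.
  rewrite cmodM cmodX (@le_trans _ _ (cmod (a k) * rho ^+ k))//.
    by rewrite ler_wpM2l ?cmod_ge0// lerXn2r ?nnegrE ?cmod_ge0.
  rewrite (_ : cmod (a k) * rho ^+ k = cmod (a k) * r ^+ k * q ^+ k); last first.
    by rewrite -mulrA -exprMn [r * q]mulrC divfK// gt_eqF.
  by rewrite ler_wpM2r ?exprn_ge0.
(* The right side is the exact partial sum of the geometric series, so the induction step closes
   with an equality. *)
have tail i : cmod (\sum_(J <= k < J + i) a k * z ^+ k) <=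
    M0 / (1 - q) * (q ^+ J - q ^+ (J + i)).
  elim: i => [|i ih]; first by rewrite addn0 big_geq// cmod0 subrr mulr0.
  rewrite addnS big_nat_recr ?leq_addr//= (le_trans (ler_cmodD _ _))//.
  rewrite (le_trans (lerD ih (zk _)))// exprS le_eqVlt; apply/orP; left.
  by apply/eqP; field.
have uz : unit_disc z by rewrite /unit_disc /= (le_lt_trans zr).
apply/ler_addgt0Pr => eps eps0.
have /cvg_cmodP/(_ _ eps0) [N _ /(_ (J + N)%N)] := fa uz.
rewrite /= leq_addl => /(_ isT).
rewrite /series /= (@big_cat_nat _ _ _ J)//= ?leq_addr// big_mkord.
set P := \sum_(i < J) _; set S := \sum_(J <= i < _) _ => fPS.
have -> : f z - P = (f z - (P + S)) + S by ring.
rewrite (le_trans (ler_cmodD _ _))// [leRHS]addrC lerD ?(ltW fPS)//.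
apply: (le_trans (tail N)); rewrite ler_wpM2l ?divr_ge0 ?subr_ge0 ?(ltW q1)//.
by rewrite gerBl exprn_ge0.
Qed.

Lemma power_series_bounded (rho : R) : 0 <= rho < 1 ->
  exists2 M, 0 <= M & forall z, cmod z <= rho -> cmod (f z) <= M.
Proof.
move=> /power_series_tail[M [q [M0 _ h]]]; exists M => // z /(h 0%N).
by rewrite big_ord0 subr0 expr0 mulr1.
Qed.

(** A pointwise limit of moduli of polynomials in [h]. *)
Lemma measurable_power_series d (T : measurableType d) (D : set T) (h : T -> R[i]) :
  measurable D -> measurable_complex D h -> (forall x, D x -> unit_disc (h x)) ->
  measurable_fun D (fun x => cmod (f (h x))).
Proof.
move=> mD mh Dh.
apply: (@measurable_fun_cvg _ _ _ _
  (fun n x => cmod (\sum_(0 <= k < n) a k * h x ^+ k))).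
  move=> n; apply: measurable_complex_cmod => //; apply: measurable_complex_sum => k _.
  by apply: measurable_complex_mul; [exact: measurable_complex_cst|exact: measurable_complex_exp].
move=> x /Dh /fa /cvg_cmodP hx; apply/cvgrPdist_lt => eps /hx.
by apply: filterS => n; exact: le_lt_trans (ler_dist_cmod _ _).
Qed.

Local Notation e := (@unit_circle_point R).
Local Notation mu := (@lebesgue_measure R).

Lemma measurable_complex_unit_circle (D : set R) (w : R[i]) :
  measurable_complex D (fun t => e t * w).
Proof.
apply: measurable_complex_mul; last exact: measurable_complex_cst.
split; apply: measurable_funTS; apply: continuous_measurable_fun.
  exact: continuous_cos.
exact: continuous_sin.
Qed.

(** Orthogonality is exact for partial sums of [f], and uniform convergence on the circle of radius
    |w| carries the estimate over to [f]. *)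
Lemma integral_pairing_ge (w : R[i]) (c : nat -> R[i]) (L : nat) :
  w != 0 -> cmod w < 1 ->
  ((2 * pi * cmod (\sum_(k < L) a k * c k))%:E <=
   \int[mu]_(t in `[0%R, (2 * pi)%R[)
     (cmod (f (e t * w)) * cmod (\sum_(k < L) c k * (e t * w) ^- k))%:E)%E.
Proof.
move=> w0 w1; set S := \sum_(k < L) _.
have pi2 : 0 < 2 * pi :> R by rewrite mulr_gt0// pi_gt0.
have cew t : cmod (e t * w) = cmod w by rewrite cmodM cmod_unit_circle mul1r.
have [M [q [M0 q01 fM]]] := @power_series_tail (cmod w) (introT andP (conj (cmod_ge0 w) w1)).
have [u u1 uS] := cmod_polar S.
pose K t := \sum_(k < L) c k * (e t * w) ^- k.
pose kappa := \sum_(k < L) cmod (c k) * cmod w ^- k.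
have kappa0 : 0 <= kappa.
  by apply: sumr_ge0 => k _; rewrite mulr_ge0 ?cmod_ge0// invr_ge0 exprn_ge0 ?cmod_ge0.
have Kk t : cmod (K t) <= kappa.
  rewrite (le_trans (ler_cmod_sum _ _ _))// ler_sum// => k _.
  by rewrite cmodM cmodV cmodX cew.
have mK D : measurable D -> measurable_fun D (fun t => cmod (K t)).
  move=> mD; apply: measurable_complex_cmod => //; apply: measurable_complex_sum => k _.
  apply: measurable_complex_mul; first exact: measurable_complex_cst.
  under eq_fun do rewrite -exprVn invfM -unit_circleN.
  apply: measurable_complex_exp; apply: measurable_complex_mul; last exact: measurable_complex_cst.
  have mN : measurable_fun D (fun t : R => - t).
    apply: measurable_funTS; apply: continuous_measurable_fun.
    by move=> x; apply: cvgN; exact: cvg_id.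
  split; apply: measurableT_comp mN; apply: continuous_measurable_fun.
    exact: continuous_cos.
  exact: continuous_sin.
have mD : measurable (`[0, 2 * pi[ : set R) by [].
have mf : measurable_fun `[0, 2 * pi[ (fun t => cmod (f (e t * w))).
  apply: measurable_power_series => //; first exact: measurable_complex_unit_circle.
  by move=> t _; rewrite /unit_disc /= cew.
set X := (\int[mu]_(t in _) _)%E.
(* Truncating [f] at J costs at most M q^J, times the bound [kappa] on the kernel and the length 2
   pi; this vanishes as J grows. *)
suff H J : (L <= J)%N ->
    ((2 * pi * cmod S)%:E <= X + (2 * pi * (kappa * (M * q ^+ J)))%:E)%E.
  apply/lee_addgt0Pr => eps eps0.
  pose C := 2 * pi * kappa * M + 1.
  have C0 : 0 < C.
    by rewrite /C ltr_wpDl// mulr_ge0// mulr_ge0// ltW.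
  have : q ^+ n @[n --> \oo] --> (0 : R).
    by apply: cvg_expr; case/andP: q01 => q0 q1; rewrite ger0_norm.
  move=> /cvgrPdist_lt /(_ (eps / C)); rewrite divr_gt0// => /(_ isT)[N _ hN].
  rewrite (le_trans (H (maxn L N) (leq_maxl _ _)))// leeD2l// lee_fin.
  have := hN (maxn L N) (leq_maxr _ _); rewrite sub0r normrN /=.
  rewrite ger0_norm; last by rewrite exprn_ge0//; case/andP: q01.
  rewrite ltr_pdivlMr// => /ltW; apply: le_trans.
  rewrite !mulrA mulrC ler_wpM2l//; first by rewrite exprn_ge0//; case/andP: q01.
  by rewrite /C lerDl.
move=> LJ.
have [cphi _] := circle_primitive_pairing u a c w0 LJ.
have := integral_circle_primitive (circle_primitive_pairing u a c w0 LJ).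
set phi := (fun t => complex.Re _) in cphi *; rewrite uS => intphi.
rewrite -[leLHS]gee0_abs; last first.
  by rewrite lee_fin mulr_ge0 ?cmod_ge0// ltW.
rewrite -intphi (le_trans (le_abse_integral _ _ _))//.
  apply/measurable_EFinP; apply: measurable_funTS.
  exact: continuous_measurable_fun.
have -> : (X + (2 * pi * (kappa * (M * q ^+ J)))%:E =
   \int[mu]_(t in `[0%R, (2 * pi)%R[)
     (cmod (f (e t * w)) * cmod (K t) + kappa * (M * q ^+ J))%:E)%E.
  under eq_integral do rewrite EFinD.
  rewrite ge0_integralD//=; last 3 first.
  - by move=> t _; rewrite lee_fin mulr_ge0 ?cmod_ge0.
  - by apply/measurable_EFinP; apply: measurable_funM => //; exact: mK.
  - by move=> t _; rewrite lee_fin !mulr_ge0// exprn_ge0//; case/andP: q01.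
  congr (_ + _)%E; rewrite integral_cst//= lebesgue_measure_itv/= lte_fin pi2.
  by rewrite -EFinB subr0 -EFinM mulrC.
apply: ge0_le_integral_subset => // [t _|t _].
  rewrite lee_fin addr_ge0 ?mulr_ge0 ?cmod_ge0// exprn_ge0//.
  by case/andP: q01.
rewrite lee_fin (le_trans (Re_le_cmod _))// cmodM.
rewrite (le_trans (ler_piMl _ u1)) ?cmod_ge0// cmodM -/(K t).
rewrite (@le_trans _ _ ((cmod (f (e t * w)) + M * q ^+ J) * cmod (K t)))//.
  rewrite ler_wpM2r ?cmod_ge0//.
  set P := \sum_(j < J) _.
  have -> : P = f (e t * w) - (f (e t * w) - P) by ring.
  rewrite (le_trans (ler_cmodB _ _))// lerD2l.
  by apply: fM; rewrite cew.
rewrite mulrDl lerD2l mulrC ler_wpM2r// mulr_ge0// exprn_ge0//.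
by case/andP: q01.
Qed.

End PowerSeries.

(** * The kernel *)

Section Kernel.
Context {R : realType}.
Local Notation e := (@unit_circle_point R).
Local Notation mu := (@lebesgue_measure R).

Lemma bernoulli_ineq (x : R) m : 0 <= x <= 1 -> 1 - m%:R * x <= (1 - x) ^+ m.
Proof.
move=> /andP[x0 x1]; elim: m => [|m ih]; first by rewrite mul0r subr0 expr0.
rewrite exprS; apply: (@le_trans _ _ ((1 - x) * (1 - m%:R * x))); last first.
  by rewrite ler_wpM2l ?subr_ge0.
rewrite -natr1; have := ler0n R m; nra.
Qed.

(** Summation by parts: multiplication by 1 - u leaves two boundary terms and the differences of
    consecutive coefficients. These differences are nonnegative and telescope, so the bound does not
    depend on the number of terms. *)
Lemma abel_summation (r : nat -> R) (u : R[i]) (A : R) (N i : nat) :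
  (forall k, 0 <= r k) -> (forall k, r k.+1 <= r k) ->
  (forall k, (k <= (N + i).+1)%N -> cmod u ^+ k <= A) ->
  cmod ((1 - u) * \sum_(N <= k < (N + i).+1) (r k)%:C * u ^+ k) <= 2 * A * r N.
Proof.
move=> r0 rS uA.
(* The upper boundary term is added back, so that each step costs exactly A times a drop of r;
   removing it at the end costs A r_{N+i} and restores 2 A r_N. *)
have H j : (j <= i)%N ->
    cmod ((1 - u) * (\sum_(N <= k < (N + j).+1) (r k)%:C * u ^+ k) +
          (r (N + j)%N)%:C * u ^+ (N + j).+1) <= A * (2 * r N - r (N + j)%N).
  elim: j => [_|j ih ji].
    rewrite addn0 big_nat1.
    have -> : (1 - u) * ((r N)%:C * u ^+ N) + (r N)%:C * u ^+ N.+1 =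
              (r N)%:C * u ^+ N by rewrite exprS; ring.
    rewrite cmodM cmod_real cmodX ger0_norm// mulrC.
    have -> : 2 * r N - r N = r N by ring.
    by rewrite ler_wpM2r// uA// ltnW// ltnS leq_addr.
  rewrite addnS big_nat_recr/= ?leqW ?leq_addr//.
  set S := \sum_(N <= k < _) _ in ih *.
  have -> : (1 - u) * (S + (r (N + j).+1)%:C * u ^+ (N + j).+1) +
     (r (N + j).+1)%:C * u ^+ (N + j).+2 =
     (1 - u) * S + (r (N + j)%N)%:C * u ^+ (N + j).+1 -
     (r (N + j)%N - r (N + j).+1)%:C * u ^+ (N + j).+1.
    by rewrite rmorphB/= [u ^+ _.+2]exprS; ring.
  rewrite (le_trans (ler_cmodB _ _))//.
  rewrite (le_trans (lerD (ih (ltnW ji)) (lexx _)))//.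
  rewrite [X in _ + X]cmodM cmod_real cmodX ger0_norm ?subr_ge0//.
  have -> : A * (2 * r N - r (N + j).+1) = A * (2 * r N - r (N + j)%N) +
     (r (N + j)%N - r (N + j).+1) * A by ring.
  by rewrite lerD2l ler_wpM2l ?subr_ge0// uA// ltnS leq_add2l ltnW.
have := H i (leqnn _); set S := \sum_(N <= k < _) _ => HS.
have -> : (1 - u) * S = (1 - u) * S + (r (N + i)%N)%:C * u ^+ (N + i).+1 -
     (r (N + i)%N)%:C * u ^+ (N + i).+1 by ring.
rewrite (le_trans (ler_cmodB _ _))// (le_trans (lerD HS (lexx _)))//.
rewrite [X in _ + X]cmodM cmod_real cmodX ger0_norm//.
have -> : 2 * A * r N = A * (2 * r N - r (N + i)%N) + r (N + i)%N * A by ring.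
by rewrite lerD2l ler_wpM2l// uA.
Qed.

(* A square of side [delta / 4] around [1 - delta]: its rotation by [e t] lies
   in the Stolz region at [e t], at distance comparable to [delta] from the circle. *)
Definition square (delta : R) : set (R * R) :=
  `[1 - delta - delta / 8, 1 - delta + delta / 8] `*`
  `[- (delta / 8), delta / 8].

Lemma squareP delta w : square delta w ->
  [/\ 1 - delta * 9 / 8 <= w.1, w.1 <= 1 - delta * 7 / 8 & `|w.2| <= delta / 8].
Proof.
case=> /=; rewrite !in_itv/= -ler_norml => /andP[h1 h2] h3; split => //; lra.
Qed.

Lemma square_cmod_ge delta w : square delta w -> 1 - delta * 9 / 8 <= cmod (cplx w).
Proof.
move=> /squareP[h _ _]; apply: (le_trans h).
by apply: le_trans (Re_le_cmod (cplx w)); exact: ler_norm.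
Qed.

Lemma square_cmod_le delta w : delta <= 1 / 4 ->
  square delta w -> cmod (cplx w) <= 1 - delta * 3 / 4.
Proof.
move=> d14 /squareP[h1 h2 h3]; apply: (le_trans (cmod_le_ReIm _)) => /=.
rewrite ger0_norm; lra.
Qed.

Lemma square_cmod_sub1 delta w :
  square delta w -> cmod (cplx w - 1) <= delta * 5 / 4.
Proof.
move=> /squareP[h1 h2 h3]; apply: (le_trans (cmod_le_ReIm _)) => /=.
rewrite subr0 ler0_norm; lra.
Qed.

(** The point sits at parameter 1 - delta on a segment ending at [e t], whose start is the rotated
    square recentred at 0 and magnified by 1 / delta. The half side delta / 8 keeps that start
    within modulus 1 / 4. *)
Lemma square_Gamma_half delta w t : 0 < delta <= 1 / 4 ->
  square delta w -> Gamma_half (e t) (e t * cplx w).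
Proof.
move=> /andP[d0 d14] Qw; right.
have dC : delta%:C != 0 :> R[i] by rewrite (fmorph_eq0 (real_complex R)) gt_eqF.
exists (e t * ((cplx w - (1 - delta)%:C) / delta%:C)).
  rewrite /mkset cmodM cmod_unit_circle mul1r cmodM cmodV cmod_real gtr0_norm//.
  rewrite ltr_pdivrMr// (le_lt_trans (cmod_le_ReIm _))//=.
  case: Qw => /=; rewrite !in_itv/= => h1 h2.
  have : `|w.1 - (1 - delta)| <= delta / 8 by rewrite ler_norml; lra.
  have : `|w.2| <= delta / 8 by rewrite ler_norml.
  rewrite subr0; lra.
exists (1 - delta); first by rewrite /=; lra.
rewrite rmorphB/= rmorph1.
by field.
Qed.

(** The trivial bound and the Abel bound, the latter in terms of 1 - z with z = [e t * cplx w], are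
    added. As z is within 5 delta / 4 of [e t], the majorant can be made to depend on t alone. *)
Lemma kernel_bound (N L n : nat) t w : (0 < N)%N -> (N < L <= N.*2)%N ->
  square (4 * N%:R)^-1 w ->
  cmod (\sum_(N <= k < L) (n + k + 1)%:R^-1 * (e t * cplx w) ^- k)
    <= 12 / (1 + N%:R * cmod (1 - e t)).
Proof.
move=> N0 /andP[NL L2] Qw; set z := e t * cplx w; set K := cmod (\sum_(_ <= _ < _) _).
set delta : R := (4 * N%:R)^-1 in Qw.
have N1 : 1 <= N%:R :> R by rewrite ler1n.
have d0 : 0 < delta by rewrite invr_gt0; lra.
have dN : delta * N%:R = 1 / 4 by rewrite /delta; field; lra.
have d14 : delta <= 1 / 4 by nra.
have zw : cmod z = cmod (cplx w) by rewrite /z cmodM cmod_unit_circle mul1r.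
have zge : 1 - delta * 9 / 8 <= cmod z by rewrite zw square_cmod_ge.
have zle : cmod z <= 1.
  by rewrite zw (le_trans (square_cmod_le d14 Qw))//; lra.
have z0 : 0 < cmod z by apply: lt_le_trans zge; lra.
have zn0 : z != 0 by apply/eqP => zz; move: z0; rewrite zz cmod0 ltxx.
(* Bernoulli: (1 - 9 delta / 8)^(2N) >= 1 - 9/16 = 7/16 > 1/3, since delta N = 1/4. *)
have uA k : (k <= N.*2)%N -> cmod z^-1 ^+ k <= 3.
  move=> k2; rewrite cmodV exprVn invf_ple ?posrE ?exprn_gt0//.
  apply: (@le_trans _ _ (cmod z ^+ N.*2)); last first.
    by rewrite ler_wiXn2l// ltW.
  apply: (@le_trans _ _ ((1 - delta * 9 / 8) ^+ N.*2)); last first.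
    by rewrite lerXn2r ?nnegrE ?(ltW z0)//; lra.
  apply: le_trans (bernoulli_ineq _ _); last by lra.
  rewrite -mul2n natrM; nra.
pose r k : R := (n + k + 1)%:R^-1.
have rE k : ((n + k + 1)%:R^-1 : R[i]) = (r k)%:C.
  by rewrite /r fmorphV rmorph_nat.
have KE : K = cmod (\sum_(N <= k < L) (r k)%:C * z^-1 ^+ k).
  by congr cmod; apply: eq_bigr => k _; rewrite rE exprVn.
have r0 k : 0 <= r k by rewrite invr_ge0.
have rS k : r k.+1 <= r k.
  by rewrite lef_pV2 ?posrE ?ltr0n ?addn1// ler_nat ltnS addnS.
have rN k : (N <= k)%N -> r k <= N%:R^-1.
  move=> Nk; rewrite lef_pV2 ?posrE ?ltr0n ?addn1// ler_nat.
  by rewrite (leq_trans Nk)// leqW// leq_addl.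
(* At most N terms, each at most 3 / N. *)
have K3 : K <= 3.
  rewrite KE (le_trans (ler_cmod_sum _ _ _))//.
  apply: (@le_trans _ _ (\sum_(N <= k < L) N%:R^-1 * 3)).
    rewrite ler_sum_nat// => k /andP[Nk kL].
    rewrite cmodM cmodX cmod_real ger0_norm// ler_pM ?exprn_ge0 ?cmod_ge0 ?rN//.
    by rewrite uA// ltnW// (leq_trans kL).
  rewrite sumr_const_nat -mulrnAl -[_ *+ (L - N)]mulr_natl.
  rewrite ler_piMl// ler_pdivrMr ?mul1r ?ler_nat; last lra.
  by rewrite leq_subLR addnn.
(* Abel summation in u = z^-1 with A = 3 gives 6 r_N <= 6 / N; the factor |z| from 1 - z = - z (1 -
   z^-1) is at most 1. *)
have K6 : N%:R * cmod (1 - z) * K <= 6.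
  have -> : 1 - z = - (z * (1 - z^-1)) by rewrite mulrBr mulr1 divff// opprB.
  rewrite cmodN cmodM mulrA -mulrA KE -cmodM.
  have [i Li] : exists i, L = (N + i).+1.
    by exists (L - N.+1)%N; rewrite -addSn subnKC.
  have := @abel_summation r z^-1 3 N i r0 rS.
  rewrite -Li => /(_ (fun k kL => uA k (leq_trans kL L2))).
  set B := cmod _ => B6; have B0 : 0 <= B by exact: cmod_ge0.
  have := rN N (leqnn _); rewrite -[_^-1]mul1r ler_pdivlMr; last lra.
  have zB : cmod z * B <= B by rewrite ler_piMl.
  rewrite -mulrA => rN1; apply: (le_trans (ler_wpM2l (ler0n R N) zB)).
  have := ler_wpM2l (ler0n R N) B6; lra.
have K0 : 0 <= K by exact: cmod_ge0.
have e0 : 0 <= cmod (1 - e t) by exact: cmod_ge0.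
rewrite ler_pdivlMr; last by rewrite ltr_pwDl// mulr_ge0//; lra.
have : cmod (1 - e t) <= cmod (1 - z) + delta * 5 / 4.
  have -> : 1 - e t = (1 - z) + e t * (cplx w - 1) by rewrite /z; ring.
  rewrite (le_trans (ler_cmodD _ _))// lerD2l cmodM cmod_unit_circle mul1r.
  exact: square_cmod_sub1.
move=> /(ler_wpM2l (ler0n R N)) /(ler_wpM2r K0) H.
rewrite mulrDr mulr1 [K * _]mulrC (le_trans (lerD K3 H))//.
(* The total is at most 3 + 6 + 3 * 5/16, below 12. *)
have -> : N%:R * (cmod (1 - z) + delta * 5 / 4) * K =
  N%:R * cmod (1 - z) * K + delta * N%:R * 5 / 4 * K by ring.
rewrite dN; lra.
Qed.

(** The minimum is the angular distance to 1. On [0, 1] the imaginary part is used, with sin t >= t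
    cos 1 by the mean value theorem; on [1, pi] the real part, with 1 - cos t >= 1 - cos 1 and t <=
    4. The other half circle follows by the symmetry t -> 2 pi - t. *)
Lemma chord_ge : exists2 kappa : R, 0 < kappa &
  forall t, 0 <= t <= 2 * pi -> kappa * Num.min t (2 * pi - t) <= cmod (1 - e t).
Proof.
have c1 : 0 < cos 1 :> R by exact: cos1_gt0.
have c1' : cos 1 < 1 :> R.
  have : cos 1 < cos 0 :> R.
    rewrite ltr_cos ?in_itv/= ?lexx ?pi_ge0 ?ltr01 ?ler01//=.
    by rewrite (le_trans _ (pi_ge2 R))// ler1n.
  by rewrite cos0.
have pi4 : pi <= 4 :> R by have := pihalf_lt2 R; lra.
pose kappa : R := Num.min (cos 1) ((1 - cos 1) / 4).
have k0 : 0 < kappa by rewrite lt_min c1 divr_gt0// subr_gt0.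
have half t : 0 <= t <= pi -> kappa * t <= cmod (1 - e t).
  move=> /andP[t0 tpi]; have [t1|t1] := leP t 1.
    apply: (@le_trans _ _ (cos 1 * t)); first by rewrite ler_wpM2r// ge_min lexx.
    apply: le_trans (Im_le_cmod _); rewrite /= sub0r normrN.
    apply: le_trans (ler_norm _).
    have [->|tn0] := eqVneq t 0; first by rewrite mulr0 sin0.
    have tgt : 0 < t by rewrite lt_def tn0.
    have [|xi + sinE] := @MVT R sin cos 0 t tgt (fun x _ => is_derive_sin x).
      by apply: continuous_subspaceT; exact: continuous_sin.
    rewrite in_itv/= => /andP[xi0 xit]; move: sinE.
    rewrite sin0 !subr0 => ->; rewrite ler_wpM2r// ltW// ltr_cos ?in_itv/=; last 2 first.
      by rewrite (ltW xi0)/= (le_trans (ltW xit)).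
      by rewrite ler01 (le_trans _ (pi_ge2 R))// ler1n.
    by rewrite (lt_le_trans xit).
  apply: (@le_trans _ _ ((1 - cos 1) / 4 * t)).
    by rewrite ler_wpM2r// ge_min lexx orbT.
  apply: le_trans (Re_le_cmod _); apply: le_trans (ler_norm _); rewrite /=.
  have : cos t < cos 1.
    rewrite ltr_cos ?in_itv/= ?t0 ?tpi//.
    by rewrite ler01 (le_trans _ (pi_ge2 R))// ler1n.
  have : 0 <= (1 - cos 1) * (4 - t) by rewrite mulr_ge0 ?subr_ge0 ?(ltW c1')//; lra.
  lra.
exists kappa => // t /andP[t0 t2]; have [tpi|tpi] := leP t pi.
  rewrite (le_trans _ (half t _)) ?t0// ler_wpM2l ?(ltW k0)//.
  by rewrite ge_min lexx.
have -> : cmod (1 - e t) = cmod (1 - e (2 * pi - t)).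
  rewrite unit_circleD unit_circle2pi mul1r unit_circleN.
  have -> : 1 - (e t)^-1 = - ((1 - e t) / e t).
    by rewrite mulrBl mul1r divff ?unit_circle_neq0// opprB.
  by rewrite cmodN cmodM cmodV cmod_unit_circle invr1 mulr1.
rewrite (le_trans _ (half _ _))//; last by lra.
by rewrite ler_wpM2l ?(ltW k0)// ge_min lexx orbT.
Qed.

(** A sum of two mirror images stands in for a power of the distance to the nearer endpoint, because
    it has one explicit primitive on the whole interval. As s > 1, each half contributes at most 1 /
    (b (s - 1)). *)
Lemma integral_powR_le (b s : R) : 0 < b -> 1 < s ->
  (\int[mu]_(t in `[0%R, (2 * pi)%R])
     ((1 + b * t) `^ (- s) + (1 + b * (2 * pi - t)) `^ (- s))%:E
   <= (2 / (b * (s - 1)))%:E)%E.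
Proof.
move=> b0 s1; have pi2 : 0 < 2 * pi :> R by rewrite mulr_gt0// pi_gt0.
have s1' : 0 < s - 1 by rewrite subr_gt0.
pose G (t : R) : R := - (b * (s - 1))^-1 * (1 + b * t) `^ (1 - s).
have pos (t : R) : 0 <= t -> 0 < 1 + b * t.
  by move=> t0; rewrite ltr_pwDl// mulr_ge0// ltW.
have dl (t : R) : is_derive t 1 (fun t => 1 + b * t) b.
  rewrite (_ : (fun t => _) = (fun t => 1 + t * b)); last first.
    by apply/funext => x; rewrite mulrC.
  by apply: is_derive_eq; rewrite /GRing.scale /=; ring.
have dG (t : R) : 0 <= t -> is_derive t 1 G ((1 + b * t) `^ (- s)).
  move=> t0.
  have dp : is_derive t 1 (fun t => (1 + b * t) `^ (1 - s))
     ((1 - s) * (1 + b * t) `^ (1 - s - 1) * b).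
    apply: (@is_derive1_comp _ (fun x => x `^ (1 - s)) (fun t => 1 + b * t)).
    by apply: is_derive1_powR; exact: pos.
  apply: is_derive_eq; rewrite /GRing.scale /=.
  have -> : 1 - s - 1 = - s by ring.
  by field; rewrite !gt_eqF.
have dr (t : R) : is_derive t 1 (fun t : R => 2 * pi - t) (-1).
  by apply: is_derive_eq; rewrite /GRing.scale /=; ring.
have dG' (t : R) : t <= 2 * pi ->
    is_derive t 1 (fun t => G (2 * pi - t)) (- (1 + b * (2 * pi - t)) `^ (- s)).
  move=> t2; rewrite -mulrN1.
  apply: (@is_derive1_comp _ G (fun t => 2 * pi - t)).
  by apply: dG; rewrite subr_ge0.
pose F (t : R) : R := G t - G (2 * pi - t).
have dF (t : R) : 0 <= t <= 2 * pi ->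
    is_derive t 1 F ((1 + b * t) `^ (- s) + (1 + b * (2 * pi - t)) `^ (- s)).
  move=> /andP[t0 t2]; have := dG t t0; have := dG' t t2 => h1 h2.
  by apply: is_derive_eq; rewrite opprK.
have cp (g : R -> R) (t : R) : is_derive t 1 g b \/ is_derive t 1 g (- b) ->
    0 < g t -> {for t, continuous (fun t => g t `^ (- s))}.
  move=> dg gt.
  have cg : {for t, continuous g}.
    by apply: differentiable_continuous; apply/derivable1_diffP; case: dg => -[].
  apply: (@continuous_comp _ _ _ g (fun x => x `^ (- s))) => //.
  apply: differentiable_continuous; apply/derivable1_diffP.
  by have [] := is_derive1_powR (- s) gt.
rewrite (@continuous_FTC2 _ _ F)//; last 3 first.
- apply: continuous_in_subspaceT => t; rewrite inE/= in_itv/= => /andP[t0 t2].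
  apply: cvgD.
    by apply: (cp (fun t => 1 + b * t)); [left|exact: pos].
  apply: (cp (fun t => 1 + b * (2 * pi - t))); last by apply: pos; rewrite subr_ge0.
  right; rewrite -mulrN1.
  exact: (@is_derive1_comp _ (fun t => 1 + b * t) (fun t => 2 * pi - t)).
- have cF (t : R) : 0 <= t <= 2 * pi -> {for t, continuous F}.
    move=> /dF[dFt _].
    by apply: differentiable_continuous; apply/derivable1_diffP.
  split.
  + by move=> t; rewrite in_itv/= => /andP[t0 t2]; case: (dF t) => //; rewrite !ltW.
  + by apply: cvg_at_right_filter; apply: cF; rewrite lexx ltW.
  + by apply: cvg_at_left_filter; apply: cF; rewrite lexx ltW.
- move=> t; rewrite in_itv/= => /andP[t0 t2]; rewrite derive1E.
  by case: (dF t) => //; rewrite !ltW.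
rewrite -EFinB lee_fin /F /G subrr subr0 mulr0 addr0 powR1.
set x := _ `^ _; have x0 : 0 <= x by exact: powR_ge0.
have : 0 < (b * (s - 1))^-1 by rewrite invr_gt0 mulr_gt0.
set y := (b * _)^-1 => y0; nra.
Qed.

(** With b = N kappa, the integrand is at most 12^s times the summand of the nearer endpoint, the
    other summand being nonnegative; the factor 1 / b yields the decay 1 / N. *)
Lemma integral_kernel_le (s : R) : 1 < s ->
  exists2 C : R, 0 < C & forall N, (0 < N)%N ->
  (\int[mu]_(t in `[0%R, (2 * pi)%R[)
     ((12 / (1 + N%:R * cmod (1 - e t))) `^ s)%:E <= (C / N%:R)%:E)%E.
Proof.
move=> s1; have [kappa k0 hk] := chord_ge.
have s0 : 0 < s by rewrite (lt_trans _ s1).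
exists (12 `^ s * (2 / (kappa * (s - 1)))).
  by rewrite mulr_gt0 ?powR_gt0 ?divr_gt0 ?mulr_gt0// subr_gt0.
move=> N N0; have N0' : 0 < N%:R :> R by rewrite ltr0n.
pose b := N%:R * kappa; have b0 : 0 < b by rewrite mulr_gt0.
pose g (t : R) := (1 + b * t) `^ (- s) + (1 + b * (2 * pi - t)) `^ (- s).
have mg : measurable_fun [set: R] g.
  have ml : measurable_fun [set: R] (fun t : R => 1 + b * t).
    apply: continuous_measurable_fun => x.
    by apply: cvgD; [exact: cvg_cst|apply: cvgM; [exact: cvg_cst|exact: cvg_id]].
  apply: measurable_funD; apply: (@measurableT_comp _ _ _ _ _ _ (fun x : R => x `^ (- s))).
  - exact: measurable_powR.
  - exact: ml.
  - exact: measurable_powR.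
  - apply: (measurableT_comp ml); apply: continuous_measurable_fun => x.
    by apply: cvgB; [exact: cvg_cst|exact: cvg_id].
have -> : ((12 `^ s * (2 / (kappa * (s - 1))) / N%:R)%:E =
   (12 `^ s)%:E * (2 / (b * (s - 1)))%:E)%E.
  rewrite -EFinM; congr (_%:E); rewrite /b; field.
  by rewrite !gt_eqF// subr_gt0.
apply: (@le_trans _ _ ((12 `^ s)%:E * \int[mu]_(t in `[0%R, (2 * pi)%R]) (g t)%:E)%E);
  last by rewrite lee_wpmul2l ?lee_fin ?powR_ge0// integral_powR_le.
rewrite -ge0_integralZl ?lee_fin ?powR_ge0//; last 2 first.
- by apply/measurable_EFinP; exact: measurable_funTS.
- by move=> t _; rewrite lee_fin addr_ge0 ?powR_ge0.
apply: ge0_le_integral_subset.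
- by move=> t /=; rewrite !in_itv/= => /andP[-> /ltW].
- by move=> t _; rewrite lee_fin powR_ge0.
- by move=> t _; rewrite -EFinM lee_fin mulr_ge0 ?addr_ge0 ?powR_ge0.
move=> t tI; have /andP[t0 /ltW t2] : 0 <= t < 2 * pi.
  by move: tI => /=; rewrite in_itv.
have h := hk t; rewrite t0 t2 in h; have {}h := h isT.
have e0 : 0 <= cmod (1 - e t) by exact: cmod_ge0.
have D0 : 0 < 1 + N%:R * cmod (1 - e t) by rewrite ltr_pwDl// mulr_ge0// ltW.
rewrite -EFinM lee_fin powRM ?invr_ge0 ?(ltW D0)//.
apply: ler_wpM2l; first exact: powR_ge0.
rewrite -powR_inv1 ?(ltW D0)// -powRrM mulN1r powRN.
have main x : 0 <= x -> kappa * x <= cmod (1 - e t) ->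
    ((1 + N%:R * cmod (1 - e t)) `^ s)^-1 <= (1 + b * x) `^ (- s).
  move=> x0 hx.
  have p1 : 0 < 1 + b * x by rewrite ltr_pwDl// mulr_ge0// ltW.
  rewrite powRN lef_pV2 ?posrE ?powR_gt0//.
  apply: ge0_ler_powR; rewrite ?nnegrE ?(ltW s0) ?(ltW p1) ?(ltW D0)//.
  by rewrite lerD2l /b -mulrA ler_wpM2l// ltW.
rewrite /g; have [tt|tt] := leP t (2 * pi - t).
  rewrite (min_idPl tt) in h.
  by rewrite (le_trans (main _ t0 h))// lerDl powR_ge0.
rewrite (min_idPr (ltW tt)) in h.
have t3 : 0 <= 2 * pi - t by rewrite subr_ge0.
by rewrite (le_trans (main _ t3 h))// lerDr powR_ge0.
Qed.

End Kernel.

(** * Block estimate in the tent space *)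

Section FubiniTonelli.
Context d1 d2 (T1 : measurableType d1) (T2 : measurableType d2) (R : realType).
Variable m1 : {sigma_finite_measure set T1 -> \bar R}.
Variable m2 : {sigma_finite_measure set T2 -> \bar R}.
Local Open Scope ereal_scope.
Variables (A : set T1) (B : set T2) (g : T1 * T2 -> \bar R).
Hypotheses (mA : measurable A) (mB : measurable B).
Hypothesis mg : measurable_fun (A `*` B) g.
Hypothesis g0 : forall x y, A x -> B y -> 0 <= g (x, y).

Let h := g \_ (A `*` B).

Let mh : measurable_fun setT h.
Proof. by apply/(measurable_restrictT _ _).1 => //; exact: measurableX. Qed.

Let h0 z : 0 <= h z.
Proof. by case: z => x y; apply: erestrict_ge0 => -[x' y'] [/= *]; exact: g0. Qed.

Let hF x : \int[m2]_y h (x, y) = ((fun x => \int[m2]_(y in B) g (x, y)) \_ A) x.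
Proof.
rewrite /patch; case: ifPn => [/set_mem Ax|Ax].
  rewrite [RHS]integral_mkcond; apply: eq_integral => y _.
  rewrite /h /patch; congr (if _ then _ else _).
  by apply/idP/idP; rewrite !inE //= => -[].
rewrite integral0_eq// => y _; rewrite /h /patch ifF//.
by apply/negbTE; apply: contra Ax; rewrite !inE => -[].
Qed.

Let hG y : \int[m1]_x h (x, y) = ((fun y => \int[m1]_(x in A) g (x, y)) \_ B) y.
Proof.
rewrite /patch; case: ifPn => [/set_mem By|By].
  rewrite [RHS]integral_mkcond; apply: eq_integral => x _.
  rewrite /h /patch; congr (if _ then _ else _).
  by apply/idP/idP; rewrite !inE //= => -[].
rewrite integral0_eq// => x _; rewrite /h /patch ifF//.
by apply/negbTE; apply: contra By; rewrite !inE => -[].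
Qed.

(** Tonelli for the extension of [g] by zero, whose partial integrals are again extensions by
    zero. *)
Lemma fubini_tonelli_setX :
  \int[m1]_(x in A) \int[m2]_(y in B) g (x, y) =
  \int[m2]_(y in B) \int[m1]_(x in A) g (x, y).
Proof.
rewrite integral_mkcond [RHS]integral_mkcond.
under eq_integral do rewrite -hF.
under [RHS]eq_integral do rewrite -hG.
exact: fubini_tonelli.
Qed.

Lemma measurable_fun_integral_setX :
  measurable_fun A (fun x => \int[m2]_(y in B) g (x, y)).
Proof.
apply/(measurable_restrictT _ _).2 => //.
rewrite [X in measurable_fun _ X](_ : _ = fun x => \int[m2]_y h (x, y)).
  exact: measurable_fun_fubini_tonelli_F.
by apply/funext => x; rewrite hF.
Qed.

End FubiniTonelli.

Section TentBound.
Context {R : realType}.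
Local Notation e := (@unit_circle_point R).
Local Notation mu := (@lebesgue_measure R).
Local Notation mu2 := (@plane_measure R).
Let mu2s : {sigma_finite_measure set (measurableTypeR R * measurableTypeR R)%type -> \bar R} :=
  mu2.
Local Notation I := (`[0%R, (2 * pi)%R[%classic : set (measurableTypeR R)).

Lemma measurable_complex_cplx d (T : measurableType d) (D : set T)
    (g : T -> measurableTypeR R * measurableTypeR R) :
  measurable_fun D g -> measurable_complex D (fun x => cplx (g x)).
Proof.
by move=> mg; split; [exact: measurableT_comp measurable_fst mg
                     |exact: measurableT_comp measurable_snd mg].
Qed.

Lemma measurable_square (delta : R) :
  measurable (square delta : set (measurableTypeR R * measurableTypeR R)).
Proof. by apply: measurableX; exact: measurable_itv. Qed.

Lemma square_measure (delta : R) : 0 < delta ->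
  mu2 (square delta) = (delta ^+ 2 / 16)%:E.
Proof.
move=> d0; rewrite /square /plane_measure product_measure1E//= !lebesgue_measure_itv/= !lte_fin.
rewrite !ifT; [|lra|lra].
by rewrite -!EFinB -EFinM; congr (_%:E); field.
Qed.

Lemma rotateK (t : R) : cancel (rotate (cos t) (sin t)) (rotate (cos t) (- sin t)).
Proof.
move=> -[x y]; rewrite /rotate /=; have cs := cos2Dsin2 t.
congr pair.
  transitivity ((cos t ^+ 2 + sin t ^+ 2) * x); last by rewrite cs mul1r.
  by ring.
transitivity ((cos t ^+ 2 + sin t ^+ 2) * y); last by rewrite cs mul1r.
by ring.
Qed.

(** Convexity of the closed disc. It makes the weight 1 - |z|^2 nonnegative on the region, hence the
    integrand of [area_integral] nonnegative. *)
Lemma Gamma_half_cmod_le (xi z : R[i]) :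
  cmod xi <= 1 -> Gamma_half xi z -> cmod z <= 1.
Proof.
move=> xi1 [[/ltW]//|[w /= w2 [s /andP[s0 s1] <-]]].
have -> : 1 - s%:C = (1 - s)%:C by rewrite rmorphB rmorph1.
rewrite (le_trans (ler_cmodD _ _))// !cmodM !cmod_real.
rewrite !ger0_norm ?subr_ge0 ?(ltW s1)//.
have : (1 - s) * cmod w <= 1 - s by rewrite ler_piMr ?subr_ge0 ?(ltW s1)//; lra.
have : s * cmod xi <= s by rewrite ler_piMr.
lra.
Qed.

Section Bound.
Variables (f : R[i] -> R[i]) (a : nat -> R[i]).
Hypothesis fa : forall z, unit_disc z ->
  series (fun k : nat => a k * z ^+ k) @ \oo --> f z.
Variables (p q delta : R).
Hypotheses (p1 : 1 < p) (q1 : 1 < q) (d01 : 0 < delta <= 1 / 4).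
Local Notation Q := (square delta).

Let d0 : 0 < delta. Proof. by case/andP: d01. Qed.
Let d14 : delta <= 1 / 4. Proof. by case/andP: d01. Qed.
Let p0 : 0 < p. Proof. exact: lt_trans p1. Qed.
Let q0 : 0 < q. Proof. exact: lt_trans q1. Qed.

Lemma square_rotate_cmod t w : Q w -> cmod (e t * cplx w) <= 1 - delta * 3 / 4.
Proof. by move=> Qw; rewrite cmodM cmod_unit_circle mul1r square_cmod_le. Qed.

Lemma square_rotate_disc t w : Q w -> unit_disc (e t * cplx w).
Proof.
move=> /(square_rotate_cmod t) h; rewrite /unit_disc /mkset (le_lt_trans h)//.
by have := d0; lra.
Qed.

Lemma measurable_circle_square :
  measurable_fun (setT `*` Q : set (measurableTypeR R * (measurableTypeR R * measurableTypeR R)))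
    (fun z => cmod (f (e z.1 * cplx z.2))).
Proof.
apply: (measurable_power_series fa); last 2 first.
- apply: measurable_complex_mul; last first.
    by apply: (measurable_complex_cplx (g := snd)); apply: measurable_funTS; exact: measurable_snd.
  split; apply: measurable_funTS.
    by apply: measurableT_comp measurable_fst; apply: continuous_measurable_fun;
      exact: continuous_cos.
  by apply: measurableT_comp measurable_fst; apply: continuous_measurable_fun;
    exact: continuous_sin.
- by move=> [t w] [_ /= Qw]; exact: square_rotate_disc.
by apply: measurableX => //; exact: measurable_square.
Qed.

Let F t w := cmod (f (e t * cplx w)).
(** The factor 9 / 4 * delta bounds 1 - |z|^2 <= 2 (1 - |z|) on the square; pi compensates the
    normalization of [dA]. *)
Let kappa := 9 / 4 * delta * pi.

Let kappa0 : 0 < kappa.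
Proof. by rewrite /kappa mulr_gt0 ?pi_gt0// mulr_gt0. Qed.

Let mFp : measurable_fun
  (setT `*` Q : set (measurableTypeR R * (measurableTypeR R * measurableTypeR R)))
    (fun z => F z.1 z.2 `^ p).
Proof.
apply: (@measurableT_comp _ _ _ _ _ _ (fun x : R => x `^ p)).
  exact: measurable_powR.
exact: measurable_circle_square.
Qed.

Let mFt t : measurable_fun (Q : set (measurableTypeR R * measurableTypeR R)) (F t).
Proof.
apply: (measurable_power_series fa).
- exact: measurable_square.
- apply: measurable_complex_mul; first exact: measurable_complex_cst.
  by apply: (measurable_complex_cplx (g := id)); exact: measurable_id.
- by move=> w; exact: square_rotate_disc.
Qed.

Let mFpt t : measurable_fun (Q : set (measurableTypeR R * measurableTypeR R))
  (fun w => F t w `^ p).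
Proof.
apply: (@measurableT_comp _ _ _ _ _ _ (fun x : R => x `^ p)).
  exact: measurable_powR.
exact: mFt.
Qed.

(** A finite minorant of the area integral at [e t], measurable in t, to which Hoelder's inequality
    in t can be applied. *)
Let A t := (\int[mu2]_(w in Q) (F t w `^ p / kappa)%:E)%E.

(** The rotated square stays in a smaller closed disc, where [f] is bounded. *)
Let A_fin t : A t \is a fin_num.
Proof.
have rho01 : 0 <= 1 - delta * 3 / 4 < 1 by have := d0; have := d14; lra.
have [M M0 fM] := power_series_bounded fa rho01.
rewrite ge0_fin_numE; last first.
  by apply: integral_ge0 => w _; rewrite lee_fin divr_ge0 ?powR_ge0// ltW.
apply: (@le_lt_trans _ _ (\int[mu2]_(w in Q) (M `^ p / kappa)%:E)%E).
  apply: ge0_le_integral_subset => // w Qw; rewrite lee_fin.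
  - by rewrite divr_ge0 ?powR_ge0// ltW.
  - by rewrite divr_ge0 ?powR_ge0// ltW.
  rewrite ler_wpM2r ?invr_ge0 ?(ltW kappa0)// ge0_ler_powR ?nnegrE ?cmod_ge0 ?(ltW p0)//.
  by apply: fM; exact: square_rotate_cmod.
rewrite integral_cst; last exact: measurable_square.
rewrite [X in (_ * X)%E](_ : _ = (delta ^+ 2 / 16)%:E); last exact: square_measure.
by rewrite -EFinM ltry.
Qed.

Let A_ge0 t : (0 <= A t)%E.
Proof. by apply: integral_ge0 => w _; rewrite lee_fin divr_ge0 ?powR_ge0// ltW. Qed.

Let mA : measurable_fun I (fun t => fine (A t)).
Proof.
apply: measurable_funTS; apply: (@measurableT_comp _ _ _ _ _ _ fine).
  by [].
apply: (@measurable_fun_integral_setX _ _ _ _ _ mu2s setT Q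
   (fun z => (F z.1 z.2 `^ p / kappa)%:E)) => //.
- exact: measurable_square.
- by apply/measurable_EFinP; apply: measurable_funM => //; exact: measurable_cst.
by move=> t w _ _; rewrite lee_fin divr_ge0 ?powR_ge0// ltW.
Qed.

(* Rotation invariance moves the square into the Stolz region at [e t], where
   [1 - |z|^2 <= 9 / 4 * delta]. *)
Let A_le_area t : (A t <= area_integral p f (e t))%E.
Proof.
pose Qt := rotate (cos t) (- sin t) @^-1` Q.
have mQt : measurable (Qt : set (measurableTypeR R * measurableTypeR R)).
  rewrite -[Qt]setTI; apply: (measurable_rotate (cos t) (- sin t)) => //.
  exact: measurable_square.
have QtP z : Qt z -> cplx z = e t * cplx (rotate (cos t) (- sin t) z).
  move=> _; rewrite unit_circle_rotate.
  have := rotateK (- t) z; rewrite cosN sinN opprK => ->.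
  by [].
have Qt_disc z : Qt z -> cmod (cplx z) <= 1 - delta * 3 / 4.
  by move=> Qz; rewrite (QtP _ Qz); exact: square_rotate_cmod.
pose g z := (cmod (f (cplx z)) `^ p / (9 / 4 * delta))%:E.
have g0 z : (0 <= g z)%E.
  by rewrite lee_fin divr_ge0 ?powR_ge0// mulr_ge0// ltW.
have mg : measurable_fun (Qt : set (measurableTypeR R * measurableTypeR R)) g.
  apply/measurable_EFinP; apply: measurable_funM; last exact: measurable_cst.
  apply: (@measurableT_comp _ _ _ _ _ _ (fun x : R => x `^ p)).
    exact: measurable_powR.
  apply: (measurable_power_series fa) => //.
    by apply: (measurable_complex_cplx (g := id)); exact: measurable_id.
  move=> z /Qt_disc h; rewrite /unit_disc /mkset (le_lt_trans h)//.
  by have := d0; lra.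
have -> : A t = (\int[dA]_(z in Qt) g z)%E.
  have -> : (\int[dA]_(z in Qt) g z = (pi^-1)%:E * \int[mu2]_(z in Qt) g z)%E.
    exact: ge0_integral_mscale.
  rewrite [in RHS]integral_mkcond.
  rewrite -(@ge0_integral_rotate _ (cos t) (sin t)) ?cos2Dsin2//; last 2 first.
  - by apply/(measurable_restrictT _ _).1.
  - by move=> z; exact: erestrict_ge0.
  rewrite -ge0_integralZl//; last 3 first.
  - apply: measurableT_comp (measurable_rotate _ _).
    by apply/(measurable_restrictT _ _).1.
  - by move=> z _; exact: erestrict_ge0.
  - by rewrite lee_fin invr_ge0 pi_ge0.
  rewrite /A [LHS]integral_mkcond; apply: eq_integral => w _.
  rewrite /patch.
  have -> : (rotate (cos t) (sin t) w \in Qt) = (w \in Q).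
    by apply/idP/idP; rewrite !inE /Qt /= rotateK.
  case: ifPn => [/set_mem Qw|_]; last by rewrite mule0.
  rewrite /g -EFinM; congr (_%:E); rewrite /F unit_circle_rotate /kappa.
  by rewrite (invfM (9 / 4 * delta)); ring.
apply: ge0_le_integral_subset => //.
- move=> z Qz; rewrite /preimage /mkset (QtP _ Qz).
  exact: (square_Gamma_half t d01 Qz).
- move=> z Gz; rewrite lee_fin divr_ge0 ?powR_ge0//.
  rewrite subr_ge0 expr_le1 ?cmod_ge0//.
  by apply: Gamma_half_cmod_le Gz; rewrite cmod_unit_circle.
move=> z Qz; rewrite lee_fin ler_wpM2l ?powR_ge0//.
have h := Qt_disc _ Qz; have c0 := cmod_ge0 (cplx z).
have h2 : cmod (cplx (rotate (cos t) (- sin t) z)) = cmod (cplx z).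
  by rewrite [in RHS](QtP _ Qz) cmodM cmod_unit_circle mul1r.
have h3 := square_cmod_ge Qz; rewrite h2 in h3.
have := d0 => d0'; rewrite lef_pV2 ?posrE; nra.
Qed.

(** The constant is (kappa / m)^(1/p), where m = delta^2 / 16 is the area of the square. The
    majorant [h] depends on t only, so that the two variables separate. *)
Lemma tent_functional_bound (c : nat -> R[i]) (L : nat) (h : R -> R) :
  measurable_fun [set: measurableTypeR R] h -> (forall t, 0 <= h t) ->
  (forall t w, Q w -> cmod (\sum_(k < L) c k * (e t * cplx w) ^- k) <= h t) ->
  ((2 * pi * cmod (\sum_(k < L) a k * c k))%:E <=
   ((36 * pi / delta) `^ p^-1)%:E *
   (\int[mu]_(t in I) (h t `^ (1 - q^-1)^-1)%:E) `^ (1 - q^-1) *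
   AT_norm p q f)%E.
Proof.
move=> mh h0 hc; set S := cmod (\sum_(k < L) _).
have mI : measurable I by exact: measurable_itv.
have mQ := measurable_square delta.
pose m := delta ^+ 2 / 16; have m0 : 0 < m by rewrite divr_gt0// exprn_gt0.
have Qm : mu2 Q = m%:E by rewrite square_measure.
have p'0 : 0 < 1 - p^-1 by rewrite subr_gt0 invf_lt1.
have q'0 : 0 < 1 - q^-1 by rewrite subr_gt0 invf_lt1.
have key w : Q w -> ((2 * pi * S)%:E <= \int[mu]_(t in I) (h t * F t w)%:E)%E.
  move=> Qw; have w1 : cmod (cplx w) < 1.
    by rewrite (le_lt_trans (square_cmod_le d14 Qw))//; have := d0; lra.
  have w0 : cplx w != 0.
    apply/eqP => wz; have := square_cmod_ge Qw; rewrite wz cmod0.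
    by have := d14; lra.
  apply: (le_trans (integral_pairing_ge fa c L w0 w1)).
  apply: ge0_le_integral_subset => // t _; rewrite lee_fin.
  - by rewrite mulr_ge0 ?cmod_ge0.
  - by rewrite mulr_ge0 ?cmod_ge0.
  by rewrite mulrC ler_wpM2r ?cmod_ge0 ?hc.
(* The left side of [key] does not depend on w, so integrating over the square multiplies it by m;
   after Tonelli, [h t] leaves the inner integral. *)
have step2 : ((2 * pi * S)%:E * m%:E <=
    \int[mu]_(t in I) ((h t)%:E * \int[mu2]_(w in Q) (F t w)%:E))%E.
  rewrite -Qm -integral_cst//.
  apply: (@le_trans _ _ (\int[mu2]_(w in Q) \int[mu]_(t in I) (h t * F t w)%:E)%E).
    apply: ge0_le_integral_subset => //.
    - by move=> w _; rewrite lee_fin !mulr_ge0 ?cmod_ge0// pi_ge0.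
    - by move=> w _; apply: integral_ge0 => t _; rewrite lee_fin mulr_ge0 ?cmod_ge0.
  rewrite -(@fubini_tonelli_setX _ _ _ _ _ mu mu2s I Q (fun z => (h z.1 * F z.1 z.2)%:E))//;
    last 2 first.
  - apply/measurable_EFinP; apply: measurable_funM.
      by apply: measurable_funTS; apply: measurableT_comp.
    apply: measurable_funS measurable_circle_square => //.
      by apply: measurableX.
    by move=> z [].
  - by move=> t w _ _; rewrite lee_fin mulr_ge0 ?cmod_ge0.
  apply: ge0_le_integral_subset => // t _.
  - by apply: integral_ge0 => w _; rewrite lee_fin mulr_ge0 ?cmod_ge0.
  - by rewrite mule_ge0 ?lee_fin//; apply: integral_ge0 => w _; rewrite lee_fin cmod_ge0.
  rewrite le_eqVlt; apply/orP; left; apply/eqP.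
  under eq_integral do rewrite EFinM.
  transitivity (\int[mu2]_(w in Q) ((h t)%:E * (F t w)%:E))%E; first by [].
  rewrite ge0_integralZl//.
  + by apply/measurable_EFinP; exact: mFt.
  + by move=> w _; rewrite lee_fin cmod_ge0.
  + by rewrite lee_fin.
(* Hoelder against the constant 1, which yields the power 1 - 1/p of the area. *)
have step3 t : (\int[mu2]_(w in Q) (F t w)%:E <=
    (m `^ (1 - p^-1) * kappa `^ p^-1 * fine (A t) `^ p^-1)%:E)%E.
  have := @hoelder_subset _ _ _ mu2 Q (F t) (fun=> 1) p (1 - p^-1)^-1 mQ (mFt t).
  rewrite invr_gt0 p'0 invrK addrC subrK.
  move=> /(_ (@measurable_cst _ _ _ _ _ _) (fun w _ => cmod_ge0 _)).
  move=> /(_ (fun _ _ => ler01) p0 isT erefl).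
  under eq_integral do rewrite mulr1.
  move/le_trans; apply.
  have -> : (\int[mu2]_(x in Q) (1 `^ (1 - p^-1)^-1)%:E = m%:E)%E.
    by rewrite powR1 integral_cst// mul1e; exact: Qm.
  have -> : (\int[mu2]_(x in Q) (F t x `^ p)%:E = (kappa * fine (A t))%:E)%E.
    rewrite EFinM fineK// /A -ge0_integralZl//; last 3 first.
    - by apply/measurable_EFinP; apply: measurable_funM => //; exact: measurable_cst.
    - by move=> w _; rewrite lee_fin divr_ge0 ?powR_ge0// ltW.
    - by rewrite lee_fin ltW.
    by apply: eq_integral => w _; rewrite -EFinM mulrC divfK// gt_eqF.
  rewrite !poweR_EFin -EFinM lee_fin powRM ?fine_ge0 ?(ltW kappa0)//.
  by rewrite le_eqVlt; apply/orP; left; apply/eqP; ring.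
pose B t := fine (A t) `^ p^-1.
have mB : measurable_fun I B.
  apply: (@measurableT_comp _ _ _ _ _ _ (fun x : R => x `^ p^-1)).
    exact: measurable_powR.
  exact: mA.
pose k := m `^ (1 - p^-1) * kappa `^ p^-1.
have k0 : 0 <= k by rewrite mulr_ge0 ?powR_ge0.
have step4 : ((2 * pi * S)%:E * m%:E <= k%:E * \int[mu]_(t in I) (h t * B t)%:E)%E.
  rewrite -ge0_integralZl//; last 2 first.
  - apply/measurable_EFinP; apply: measurable_funM => //.
    exact: measurable_funTS.
  - by move=> t _; rewrite lee_fin mulr_ge0 ?powR_ge0.
  apply: (le_trans step2); apply: ge0_le_integral_subset => // t _.
  - by rewrite mule_ge0 ?lee_fin//; apply: integral_ge0 => w _; rewrite lee_fin cmod_ge0.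
  - by rewrite -EFinM lee_fin !mulr_ge0 ?powR_ge0.
  apply: (@le_trans _ _ ((h t)%:E * (k * B t)%:E)%E).
    by apply: lee_wpmul2l; [rewrite lee_fin; exact: h0|exact: step3].
  by rewrite -!EFinM lee_fin mulrCA.
have step5 : (\int[mu]_(t in I) (h t * B t)%:E <=
   (\int[mu]_(t in I) (h t `^ (1 - q^-1)^-1)%:E) `^ (1 - q^-1) * AT_norm p q f)%E.
  have := @hoelder_subset _ _ _ mu I h B (1 - q^-1)^-1 q mI
     (measurable_funTS mh) mB (fun t _ => h0 t) (fun t _ => powR_ge0 _ _).
  rewrite invr_gt0 q'0 invrK subrK => /(_ isT q0 erefl).
  move/le_trans; apply; apply: lee_wpmul2l; first exact: poweR_ge0.
  apply: gt0_ler_poweR.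
  - by rewrite invr_ge0 ltW.
  - by rewrite in_itv/= leey andbT; apply: integral_ge0 => t _; rewrite lee_fin powR_ge0.
  - by rewrite in_itv/= leey andbT; apply: integral_ge0 => t _; rewrite poweR_ge0.
  apply: ge0_le_integral_subset => // t _.
  - by rewrite lee_fin powR_ge0.
  - by rewrite poweR_ge0.
  (* The power q of [B t] is the power q / p of [A t], as in [AT_norm]. *)
  rewrite /B -powRrM mulrC -poweR_EFin fineK//.
  apply: gt0_ler_poweR.
  - by rewrite divr_ge0 ?(ltW p0) ?(ltW q0).
  - by rewrite in_itv/= leey andbT.
  - by rewrite in_itv/= leey andbT (le_trans (A_ge0 t)).
  - exact: A_le_area.
have : ((2 * pi * S)%:E * m%:E <= k%:E *
   ((\int[mu]_(t in I) (h t `^ (1 - q^-1)^-1)%:E) `^ (1 - q^-1) * AT_norm p q f))%E.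
  by apply: (le_trans step4); apply: lee_wpmul2l; [rewrite lee_fin|exact: step5].
set X := (_ `^ (1 - q^-1))%E; set N := AT_norm p q f => hS.
have N0 : (0 <= X * N)%E by rewrite mule_ge0 ?poweR_ge0.
have -> : (36 * pi / delta) `^ p^-1 = m^-1 * k.
  rewrite /k mulrA powRD ?gt_eqF ?implybT// powRr1 ?(ltW m0)// mulrA.
  rewrite mulVf ?gt_eqF// mul1r -[- p^-1]mulN1r powRrM powR_inv1 ?(ltW m0)//.
  rewrite -powRM ?invr_ge0 ?(ltW m0) ?(ltW kappa0)//.
  congr (_ `^ _); rewrite /m /kappa; field; by rewrite gt_eqF.
rewrite -!muleA.
apply: (@le_trans _ _ ((m^-1)%:E * ((2 * pi * S)%:E * m%:E))%E).
  by rewrite -!EFinM mulrCA mulVf ?mulr1// gt_eqF.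
rewrite [X in (_ <= X * _)%E]EFinM -[leRHS]muleA.
by apply: lee_wpmul2l; [rewrite lee_fin invr_ge0 ltW|exact: hS].
Qed.

End Bound.
End TentBound.

(** * Dyadic summation *)

Section DyadicCauchy.
Context {R : realType}.

Lemma real_cauchy_cvg (v : nat -> R) :
  (forall eps : R, 0 < eps -> exists N, forall n, (N <= n)%N -> `|v N - v n| < eps) ->
  cvgn v.
Proof.
move=> h; apply: cauchy_cvg; apply: cauchy_exP => eps eps0.
by have [N hN] := h eps eps0; exists (v N); exists N => // n /= /hN.
Qed.

Lemma complex_cauchy_cvg (u : nat -> R[i]) :
  (forall eps : R, 0 < eps -> exists N, forall n, (N <= n)%N -> cmod (u N - u n) < eps) ->
  cvgn u.
Proof.
move=> h.
have hRe : cvgn (fun n => complex.Re (u n)).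
  apply: real_cauchy_cvg => eps /h[N hN]; exists N => n /hN; apply: le_lt_trans.
  by case: (u N) (u n) => ? ? [? ?]; exact: (Re_le_cmod (_ +i* _ - _ +i* _)).
have hIm : cvgn (fun n => complex.Im (u n)).
  apply: real_cauchy_cvg => eps /h[N hN]; exists N => n /hN; apply: le_lt_trans.
  by case: (u N) (u n) => ? ? [? ?]; exact: (Im_le_cmod (_ +i* _ - _ +i* _)).
apply/cvg_ex; exists (limn (fun n => complex.Re (u n)) +i*
                      limn (fun n => complex.Im (u n))).
apply/cvg_cmodP => eps eps0.
have eps2 : 0 < eps / 2 by rewrite divr_gt0.
move/cvgrPdist_lt : hRe => /(_ _ eps2) hRe; move/cvgrPdist_lt : hIm => /(_ _ eps2) hIm.
apply: filterS2 hRe hIm => n; move: (limn _) (limn _) => x y h1 h2.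
apply: le_lt_trans (cmod_le_ReIm _) _; move: h1 h2; case: (u n) => x' y' /=; lra.
Qed.

(** The path from 2^j to L passes through the powers of two in between, and the block increments are
    summed as an exact finite geometric series. *)
Lemma dyadic_tail (u : nat -> R[i]) (B rho : R) : 0 <= B -> 0 <= rho < 1 ->
  (forall j L, (2 ^ j <= L <= 2 ^ j.+1)%N -> cmod (u L - u (2 ^ j)%N) <= B * rho ^+ j) ->
  forall j L, (2 ^ j <= L)%N -> cmod (u L - u (2 ^ j)%N) <= B / (1 - rho) * rho ^+ j.
Proof.
move=> B0 /andP[r0 r1] h j L jL.
have r1' : 0 < 1 - rho by rewrite subr_gt0.
have D0 : 0 <= B / (1 - rho) by rewrite divr_ge0// ltW.
have H i L' : (2 ^ j <= L' <= 2 ^ (j + i))%N ->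
    cmod (u L' - u (2 ^ j)%N) <= B / (1 - rho) * (rho ^+ j - rho ^+ (j + i)).
  elim: i L' => [|i ih] L'.
    by rewrite addn0 -eqn_leq => /eqP <-; rewrite !subrr cmod0 mulr0.
  move=> /andP[jL' L'i]; have [L'j|L'j] := leqP L' (2 ^ (j + i)).
    apply: (le_trans (ih _ _)); first by rewrite jL'.
    rewrite ler_wpM2l// lerD2l lerN2 addnS exprS ler_piMl ?exprn_ge0//.
    exact: ltW.
  have -> : u L' - u (2 ^ j)%N = (u L' - u (2 ^ (j + i))%N) +
                               (u (2 ^ (j + i))%N - u (2 ^ j)%N) by ring.
  have h1 : cmod (u L' - u (2 ^ (j + i))%N) <= B * rho ^+ (j + i).
    by apply: h; rewrite (ltnW L'j) -addnS.
  have h2 := ih (2 ^ (j + i))%N; rewrite leqnn leq_exp2l// leq_addr in h2.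
  rewrite (le_trans (ler_cmodD _ _))// (le_trans (lerD h1 (h2 isT)))//.
  rewrite addnS exprS le_eqVlt; apply/orP; left; apply/eqP; field.
  by rewrite gt_eqF.
(* L blocks are more than enough, since L < 2^L. *)
apply: (le_trans (H L _ _)).
  by rewrite jL/= (leq_trans (ltnW (ltn_expl L (isT : 1 < 2)%N)))// leq_exp2l// leq_addl.
by rewrite ler_wpM2l// gerBl exprn_ge0.
Qed.

(** The blocks start at 2^0 = 1, so the value [u 1] appears in the bound and has to be controlled
    separately. *)
Lemma dyadic_cvg (u : nat -> R[i]) (B rho : R) : 0 <= B -> 0 <= rho < 1 ->
  (forall j L, (2 ^ j <= L <= 2 ^ j.+1)%N -> cmod (u L - u (2 ^ j)%N) <= B * rho ^+ j) ->
  cvgn u /\ cmod (limn u) <= cmod (u 1) + B / (1 - rho).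
Proof.
move=> B0 r01 h; have tail := dyadic_tail B0 r01 h.
have /andP[r0 r1] := r01.
have cu : cvgn u.
  apply: complex_cauchy_cvg => eps eps0.
  pose C := B / (1 - rho) + 1.
  have C0 : 0 < C by rewrite ltr_pwDr// divr_ge0// subr_ge0 ltW.
  have : rho ^+ n @[n --> \oo] --> (0 : R).
    by apply: cvg_expr; rewrite ger0_norm.
  move=> /cvgrPdist_lt /(_ (eps / C)); rewrite divr_gt0// => /(_ isT)[N _ hN].
  exists (2 ^ N)%N => n Nn; rewrite -cmodN opprB.
  apply: (le_lt_trans (tail _ _ Nn)).
  have := hN N (leqnn _); rewrite /= sub0r normrN ger0_norm ?exprn_ge0//.
  rewrite ltr_pdivlMr//; apply: le_lt_trans.
  by rewrite mulrC ler_wpM2l ?exprn_ge0// lerDl.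
split=> //; apply/ler_addgt0Pr => eps eps0.
have /cvg_cmodP/(_ _ eps0)[N _ hN] : u @ \oo --> limn u by [].
have := hN N.+1 (leqnSn _) => /= lu.
have -> : limn u = u 1%N + (u N.+1 - u 1%N) + (limn u - u N.+1) by ring.
apply: (le_trans (ler_cmodD _ _)); apply: lerD; last exact: ltW.
apply: (le_trans (ler_cmodD _ _)); rewrite lerD2l.
by have := tail 0%N N.+1; rewrite expn0 expr0 mulr1; apply.
Qed.

End DyadicCauchy.

Section Main.
Context {R : realType}.
Variables p q : R.
Hypotheses (p1 : 1 < p) (q1 : 1 < q).
Local Notation e := (@unit_circle_point R).
Local Notation mu := (@lebesgue_measure R).

Let q'0 : 0 < 1 - q^-1.
Proof. by rewrite subr_gt0 invf_lt1// (lt_trans _ q1). Qed.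

Let pi2 : 0 < 2 * pi :> R. Proof. by rewrite mulr_gt0// pi_gt0. Qed.

Lemma AT_norm_ge0 (f : R[i] -> R[i]) : (0 <= AT_norm p q f)%E.
Proof. exact: poweR_ge0. Qed.

(** The index 0 belongs to no dyadic block. The functional bound is used with the kernel 1 and delta
    = 1 / 4, the largest value allowed. *)
Lemma leading_coefficient_bound : exists2 C : R, 0 < C &
  forall (f : R[i] -> R[i]) (a : nat -> R[i]),
  (forall z, unit_disc z -> series (fun k => a k * z ^+ k) @ \oo --> f z) ->
  ((cmod (a 0%N))%:E <= C%:E * AT_norm p q f)%E.
Proof.
pose C := (36 * pi / (1 / 4)) `^ p^-1 * (2 * pi) `^ (1 - q^-1) / (2 * pi) : R.
have C0 : 0 < C by rewrite divr_gt0// mulr_gt0// powR_gt0// ?divr_gt0 ?mulr_gt0 ?pi_gt0.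
exists C => // f a fa.
have d01 : 0 < (1 / 4 : R) <= 1 / 4 by lra.
have := @tent_functional_bound _ f a fa p q (1 / 4) p1 q1 d01 (fun=> 1) 1 (fun=> 1)
  (measurable_cst _) (fun=> ler01).
rewrite !big_ord1 mulr1.
have h1 t (w : R * R) : square (1 / 4) w ->
    cmod (\sum_(k < 1) 1 * (e t * cplx w) ^- k) <= 1.
  by move=> _; rewrite big_ord1 expr0 invr1 mulr1 cmod1.
move=> /(_ h1); have -> : (\int[mu]_(t in `[0%R, (2 * pi)%R[)
    (1 `^ (1 - q^-1)^-1)%:E = (2 * pi)%:E)%E.
  rewrite powR1 integral_cst//= lebesgue_measure_itv/= lte_fin pi2 mul1e.
  by rewrite -EFinB subr0.
rewrite poweR_EFin -EFinM => h.
have -> : (cmod (a 0%N) = (2 * pi)^-1 * (2 * pi * cmod (a 0%N))).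
  by rewrite mulKf// gt_eqF.
rewrite EFinM /C [_ / (2 * pi)]mulrC [X in (_ <= X * _)%E]EFinM -[leRHS]muleA.
by apply: lee_wpmul2l; [rewrite lee_fin invr_ge0 ltW|exact: h].
Qed.

(** With delta = 1 / (4N), the functional bound contributes (144 pi N)^(1/p) and the kernel (C1 /
    N)^(1 - 1/q), where [s] is the exponent conjugate to q. *)
Lemma block_bound : exists2 C : R, 0 < C &
  forall (f : R[i] -> R[i]) (a : nat -> R[i]),
  (forall z, unit_disc z -> series (fun k => a k * z ^+ k) @ \oo --> f z) ->
  forall n N L, (0 < N)%N -> (N < L <= N.*2)%N ->
  ((cmod (\sum_(N <= k < L) a k / (n + k + 1)%:R))%:E <=
   (C * N%:R `^ (p^-1 + q^-1 - 1))%:E * AT_norm p q f)%E.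
Proof.
pose s := (1 - q^-1)^-1.
have s1 : 1 < s.
  rewrite /s -invf_lt1 ?invr_gt0// invrK ltrBlDr ltrDl invr_gt0.
  exact: lt_trans q1.
have [C1 C10 hC1] := integral_kernel_le s1.
pose C := (144 * pi) `^ p^-1 * C1 `^ (1 - q^-1) / (2 * pi).
have C0 : 0 < C by rewrite divr_gt0// mulr_gt0// powR_gt0// mulr_gt0// pi_gt0.
exists C => // f a fa n N L N0 NL.
have N0' : 0 < N%:R :> R by rewrite ltr0n.
have N1 : 1 <= N%:R :> R by rewrite ler1n.
pose delta : R := (4 * N%:R)^-1.
have d01 : 0 < delta <= 1 / 4.
  have dN : delta * N%:R = 1 / 4 by rewrite /delta; field; lra.
  have d0 : 0 < delta by rewrite invr_gt0 mulr_gt0.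
  rewrite d0; nra.
(* Zero coefficients below N turn the functional over all [k < L] into the block. *)
pose c k : R[i] := if (N <= k)%N then (n + k + 1)%:R^-1 else 0.
pose h t := 12 / (1 + N%:R * cmod (1 - e t)).
have den t : 0 < 1 + N%:R * cmod (1 - e t).
  by rewrite ltr_pwDl// mulr_ge0// cmod_ge0.
have h0 t : 0 <= h t by rewrite divr_ge0// ltW.
have mh : measurable_fun [set: measurableTypeR R] h.
  rewrite (_ : h = fun t => 12 * ((1 + N%:R * cmod (1 - e t)) `^ (-1))); last first.
    by apply/funext => t; rewrite powR_inv1// ltW.
  apply: measurable_funM; first exact: measurable_cst.
  apply: (@measurableT_comp _ _ _ _ _ _ (fun x : R => x `^ (- 1))).
    exact: measurable_powR.
  apply: measurable_funD; first exact: measurable_cst.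
  apply: measurable_funM; first exact: measurable_cst.
  apply: measurable_complex_cmod => //; split.
    apply: continuous_measurable_fun => t; apply: cvgB; first exact: cvg_cst.
    exact: continuous_cos.
  apply: continuous_measurable_fun => t; apply: cvgB; first exact: cvg_cst.
  exact: continuous_sin.
have sumc (F : nat -> R[i]) :
    \sum_(k < L) F k * c k = \sum_(N <= k < L) F k / (n + k + 1)%:R.
  rewrite big_geq_mkord [RHS]big_mkcond/=; apply: eq_bigr => k _.
  by rewrite /c; case: ifP => // _; rewrite mulr0.
have hc t w : square delta w -> cmod (\sum_(k < L) c k * (e t * cplx w) ^- k) <= h t.
  move=> Qw; under eq_bigr do rewrite mulrC.
  rewrite (sumc (fun k => (e t * cplx w) ^- k)).
  under eq_bigr do rewrite mulrC.
  exact: kernel_bound.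
have := @tent_functional_bound _ f a fa p q delta p1 q1 d01 c L h mh h0 hc.
rewrite sumc; set S := cmod _ => hS.
have -> : S = (2 * pi)^-1 * (2 * pi * S) by rewrite mulKf// gt_eqF.
have -> : C * N%:R `^ (p^-1 + q^-1 - 1) =
    (2 * pi)^-1 * ((36 * pi / delta) `^ p^-1 * (C1 / N%:R) `^ (1 - q^-1)).
  rewrite /C mulrC [_ / (2 * pi)]mulrC mulrCA; congr (_ * _).
  rewrite /delta invrK.
  have -> : 36 * pi * (4 * N%:R) = 144 * pi * N%:R :> R by ring.
  rewrite !powRM ?invr_ge0 ?mulr_ge0 ?pi_ge0 ?(ltW C10) ?(ltW N0')//.
  rewrite -[N%:R^-1]powR_inv1 ?(ltW N0')// -powRrM.
  have -> : p^-1 + q^-1 - 1 = p^-1 + (-1 * (1 - q^-1)) by ring.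
  rewrite powRD; last by apply/implyP => _; rewrite gt_eqF.
  by move: (N%:R `^ p^-1) (N%:R `^ (-1 * _)) => x y; ring.
rewrite EFinM [X in (_ <= X * _)%E]EFinM -muleA.
apply: lee_wpmul2l; first by rewrite lee_fin invr_ge0 ltW.
apply: (le_trans hS); apply: lee_wpmul2r; first exact: AT_norm_ge0.
rewrite EFinM; apply: lee_wpmul2l; first by rewrite lee_fin powR_ge0.
rewrite -poweR_EFin; apply: gt0_ler_poweR.
- exact: ltW.
- by rewrite in_itv/= leey andbT; apply: integral_ge0 => t _; rewrite lee_fin powR_ge0.
- by rewrite in_itv/= leey andbT lee_fin divr_ge0 ?(ltW C10).
exact: hC1.
Qed.

Lemma series_bound : p^-1 + q^-1 < 1 -> exists2 C : R, 0 < C &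
  forall (f : R[i] -> R[i]) (a : nat -> R[i]), AT_space p q f ->
  (forall z, unit_disc z -> series (fun k => a k * z ^+ k) @ \oo --> f z) ->
  forall n, let u := series (fun k => a k / (n + k + 1)%:R) in
  cvgn u /\ ((cmod (limn u))%:E <= C%:E * AT_norm p q f)%E.
Proof.
move=> pq; have [C0 C00 hC0] := leading_coefficient_bound.
have [C1 C10 hC1] := block_bound.
(* The block bound at N = 2^j is a multiple of rho^j, and rho < 1 is the condition on p and q. *)
pose rho : R := 2 `^ (p^-1 + q^-1 - 1).
have rho0 : 0 < rho by exact: powR_gt0.
have rho1 : rho < 1.
  rewrite /rho /powR gt_eqF// expR_lt1 pmulr_llt0; first by lra.
  by rewrite ln_gt0// ltr1n.
have rho1' : 0 < 1 - rho by rewrite subr_gt0.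
exists (C0 + C1 / (1 - rho)); first by rewrite addr_gt0// divr_gt0.
move=> f a [_ ffin] fa n u.
have fE : AT_norm p q f \is a fin_num by rewrite ge0_fin_numE// AT_norm_ge0.
have {}hC0 := hC0 f a fa; have {}hC1 := hC1 f a fa n.
move: hC0 hC1; rewrite -(fineK fE); set M := fine _ => hC0 hC1.
have M0 : 0 <= M by rewrite fine_ge0// AT_norm_ge0.
move: hC0; rewrite -EFinM lee_fin => hC0.
have [||j L /andP[jL L2]|cu lu] := @dyadic_cvg R u (C1 * M) rho.
- by rewrite mulr_ge0// ltW.
- by rewrite ltW.
(* The empty block is set apart, because [block_bound] asks for [N < L]. *)
- have [Lj|Lj] := eqVneq L (2 ^ j)%N.
    by rewrite Lj subrr cmod0 !mulr_ge0 ?exprn_ge0// ltW.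
  have := hC1 (2 ^ j)%N L; rewrite expn_gt0/= ltn_neqAle eq_sym Lj jL/=.
  rewrite -mul2n -expnS L2 => /(_ isT isT).
  rewrite -EFinM lee_fin; congr (cmod _ <= _).
    rewrite /u /series /= (@big_cat_nat _ _ _ (2 ^ j) 0 L)//=.
    by ring.
  rewrite mulrAC; congr (_ * _); rewrite /rho natrX -powR_mulrn//.
  by rewrite -powR_mulrn ?powR_ge0// -!powRrM mulrC.
split=> //; rewrite -EFinM lee_fin (le_trans lu)// mulrDl lerD//; last first.
  by rewrite mulrAC.
(* [u 1] is the single term a_0 / (n + 1), of modulus at most |a_0|, whatever n is. *)
rewrite /u /series /= big_nat1 cmodM cmodV cmod_natr.
apply: le_trans hC0; rewrite ler_piMr ?cmod_ge0// invf_le1 ?ltr0n ?addn1//.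
by rewrite ler1n.
Qed.

End Main.

Local Close Scope complex_scope.
Unset Implicit Arguments.

Theorem proposition1p2 (R : realType) (p q : R)
    (hp : 1 < p) (hq : 1 < q) (hpq : p^-1 + q^-1 < 1) :
  (forall (f : R[i] -> R[i]) (a : nat -> R[i]),
     AT_space p q f ->
     (forall z : R[i], unit_disc z ->
        series (fun k : nat => a k * z ^+ k) @ \oo --> f z) ->
     forall n : nat,
       cvgn (series (fun k : nat => a k / (n + k + 1)%:R))) /\
  (exists C : R, 0 < C /\
     forall (f : R[i] -> R[i]) (a : nat -> R[i]),
       AT_space p q f ->
       (forall z : R[i], unit_disc z ->
          series (fun k : nat => a k * z ^+ k) @ \oo --> f z) ->
       (ereal_sup (range (fun n : nat =>
          (cmod (limn (series (fun k : nat => a k / (n + k + 1)%:R))))%:E))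
        <= C%:E * AT_norm p q f)%E).
Proof.
have [C C0 hC] := series_bound hp hq hpq.
split; first by move=> f a ATf fa n; have [] := hC f a ATf fa n.
exists C; split=> // f a ATf fa; apply: ge_ereal_sup => _ [n _ <-].
by have [] := hC f a ATf fa n.
Qed.
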